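(* The problem SATISFACTION for oblivious models corresponding to strong hierarchical influence games is solvable in polynomial time. That is, there is a polynomial time algorithm that, given a strong hierarchical influence game $\Gamma=(G,f,q,N)$ and an actor $i\in V(G)$, computes $\mathrm{Sat}_{\mathcal{M}^o(\Gamma)}(i)$.
   Context: Graphs are finite, directed, without loops or multiple edges; $P_G(i)=\{j\mid (j,i)\in E\}$, $S_G(i)=\{j\mid(i,j)\in E\}$. For a digraph $G$: $\mathtt{L}(G)=\{i\mid P_G(i)=\emptyset, S_G(i)\ne\emptyset\}$, $\mathtt{F}(G)=\{i\mid S_G(i)=\emptyset, P_G(i)\ne\emptyset\}$, $\mathtt{I}(G)=\{i\mid S_G(i)=P_G(i)=\emptyset\}$, $\mathtt{FI}(G)=\mathtt{F}(G)\cup\mathtt{I}(G)$. Strong hierarchical graphs are defined recursively: (1) the graph $I_a$ of $a>0$ isolated vertices is one; (2) if $H_1,H_2$ are vertex-disjoint strong hierarchical graphs, so is their disjoint union $H_1+H_2$; (3) if $H$ is one and $V'\ne\emptyset$ is a set of vertices with $V(H)\cap V'=\emptyset$, so is $H\otimes V'$, the graph with vertex set $V(H)\cup V'$ and edge set $E(H)\cup\{(u,v)\mid u\in\mathtt{FI}(H),v\in V'\}$. An influence graph is a pair $(G,f)$ with $G=(V,E)$ a digraph and $f$ assigning to each vertex a non-negative rational. For $X\subseteq V$, $n=|V|$: $F^0(X)=X$, $F^t(X)=F^{t-1}(X)\cup\{i\in V\mid |P_G(i)\cap F^{t-1}(X)|\ge f(i)\}$ for $1\le t\le n$, and $F(X)=F^n(X)$.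 An influence game is $\Gamma=(G,f,q,N)$ with $(G,f)$ an influence graph, $q$ an integer, $0\le q\le n$, and $N\subseteq V$. It is a strong hierarchical influence game if $G$ is a strong hierarchical graph and $N=\mathtt{L}(G)\cup\mathtt{I}(G)$. The oblivious influence model $\mathcal{M}^o(\Gamma)$ (for $f$ positive, i.e. $f(i)>0$ for all $i$) has collective decision function $C(x)=1$ if $|F(X(x)\cap N)|\ge q$ and $C(x)=0$ otherwise, for $x\in\{0,1\}^n$, where $X(x)=\{i\mid x_i=1\}$. The satisfaction of actor $i$ is $\mathrm{Sat}(i)=|\{x\in\{0,1\}^n\mid C(x)=x_i\}|$. *)

(* Defs.v *)
From mathcomp Require Import all_boot all_order all_algebra.

Set Implicit Arguments.
Unset Strict Implicit.
Unset Printing Implicit Defensive.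

Import Order.TTheory GRing.Theory Num.Theory.

(** * Directed graphs *)

(* All graphs that occur in one construction live inside a common finite type
   T, so a graph carries its own vertex set; this is what gives meaning to
   isolated vertices and to vertex-disjointness. *)
Record digraph (T : finType) := Digraph {
  verts : {set T};
  edges : {set T * T}
}.

Section Digraph.
Variables (T : finType) (G : digraph T).

Definition predecessors (i : T) : {set T} :=
  [set j in verts G | (j, i) \in edges G].
Definition successors (i : T) : {set T} :=
  [set j in verts G | (i, j) \in edges G].

Definition Lset : {set T} :=
  [set i in verts G | (predecessors i == set0) && (successors i != set0)].
Definition Fset : {set T} :=
  [set i in verts G | (successors i == set0) && (predecessors i != set0)].
Definition Iset : {set T} :=
  [set i in verts G | (successors i == set0) && (predecessors i == set0)].
Definition FIset : {set T} := Fset :|: Iset.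

End Digraph.

Inductive strong_hierarchical (T : finType) : digraph T -> Prop :=
| SH_isolated (A : {set T}) :
    A != set0 -> strong_hierarchical (Digraph A set0)
| SH_union (H1 H2 : digraph T) :
    strong_hierarchical H1 -> strong_hierarchical H2 ->
    [disjoint verts H1 & verts H2] ->
    strong_hierarchical
      (Digraph (verts H1 :|: verts H2) (edges H1 :|: edges H2))
| SH_extend (H : digraph T) (B : {set T}) :
    strong_hierarchical H -> B != set0 -> [disjoint verts H & B] ->
    strong_hierarchical
      (Digraph (verts H :|: B) (edges H :|: setX (FIset H) B)).

(** * Influence games *)

(* The vertices of the game are all the elements of V; absence of multiple
   edges is built into the use of a set of pairs. *)
Record influence_game (V : finType) := InfluenceGame {
  game_edges : {set V * V};
  label : V -> rat;
  quota : nat;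
  players : {set V};
  game_loopless : forall v, (v, v) \notin game_edges;
  label_ge0 : forall v, (0 <= label v)%R;
  quota_le : quota <= #|V|
}.

Section InfluenceGame.
Variables (V : finType) (g : influence_game V).

Definition game_graph : digraph V := Digraph [set: V] (game_edges g).

Definition spread_step (Y : {set V}) : {set V} :=
  Y :|: [set i | (label g i <= #|predecessors game_graph i :&: Y|%:R)%R].

Definition spread (X : {set V}) : {set V} := iter #|V| spread_step X.

Definition strong_hierarchical_game : Prop :=
  strong_hierarchical game_graph /\
  players g = Lset game_graph :|: Iset game_graph.

Definition positive_labels : Prop := forall v, (0 < label g v)%R.

Definition oblivious_decision (x : {ffun V -> bool}) : bool :=
  quota g <= #|spread ([set i | x i] :&: players g)|.

Definition Sat (i : V) : nat :=
  #|[set x : {ffun V -> bool} | oblivious_decision x == x i]|.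

End InfluenceGame.

(** * Polynomial time *)

(* Deterministic multi-tape Turing machines.  A cell is blank ([None]), holds
   an input/output bit, or holds one of finitely many auxiliary symbols. *)
Definition cell (aux : finType) : finType := option (bool + aux)%type.

Inductive move := MoveLeft | Stay | MoveRight.

Record turing_machine := TuringMachine {
  tm_state : finType;
  tm_aux : finType;
  tm_tapes : nat; (* there are [tm_tapes.+1] tapes *)
  tm_start : tm_state;
  tm_halting : pred tm_state;
  tm_trans : tm_state -> {ffun 'I_tm_tapes.+1 -> cell tm_aux} ->
             tm_state * {ffun 'I_tm_tapes.+1 -> cell tm_aux * move}
}.

(* [(l, r)] is a two-way infinite tape: [r] lists the cells from the scanned
   one rightwards, [l] those to its left, nearest first; all the cells beyond
   these lists are blank. *)
Definition tape (aux : finType) : Type :=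
  (seq (cell aux) * seq (cell aux))%type.

Section Tape.
Variable aux : finType.

Definition tape_read (t : tape aux) : cell aux := head None t.2.

Definition tape_write (a : cell aux) (t : tape aux) : tape aux :=
  (t.1, a :: behead t.2).

Definition tape_move (m : move) (t : tape aux) : tape aux :=
  match m with
  | MoveLeft => (behead t.1, head None t.1 :: t.2)
  | Stay => t
  | MoveRight => (head None t.2 :: t.1, behead t.2)
  end.

Fixpoint leading_bits (s : seq (cell aux)) : seq bool :=
  if s is Some (inl b) :: s' then b :: leading_bits s' else [::].

End Tape.

Section Run.
Variable M : turing_machine.

Definition tm_config : Type :=
  (tm_state M * {ffun 'I_(tm_tapes M).+1 -> tape (tm_aux M)})%type.

Definition tm_step (c : tm_config) : tm_config :=
  if tm_halting c.1 then c else
  let: (s, act) := tm_trans c.1 [ffun k => tape_read (c.2 k)] in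
  (s, [ffun k => tape_move (act k).2 (tape_write (act k).1 (c.2 k))]).

(* Tape 0 is both the input and the output tape. *)
Definition tm_init (w : seq bool) : tm_config :=
  (tm_start M,
   [ffun k => if k == ord0 then ([::], [seq Some (inl b) | b <- w])
              else ([::], [::])]).

Definition tm_output (c : tm_config) : seq bool := leading_bits (c.2 ord0).2.

(* Halting configurations are fixed points of [tm_step], so this says that M
   halts on w after at most t steps with output o. *)
Definition tm_computes_within (w : seq bool) (t : nat) (o : seq bool) : Prop :=
  let c := iter t tm_step (tm_init w) in tm_halting c.1 /\ tm_output c = o.

End Run.

(* On inputs outside [valid] nothing is required of the machine. *)
Definition polytime_computable (I : Type) (valid : I -> Prop)
    (input output : I -> seq bool) : Prop :=
  exists (M : turing_machine) (c d : nat), forall x : I, valid x ->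
    tm_computes_within M (input x) (c * size (input x) ^ d + c) (output x).

(** * Encoding of instances *)

(* Binary notation without leading zeros, least significant bit first. *)
Definition binary (n : nat) : seq bool :=
  mkseq (fun k => odd (n %/ 2 ^ k)) (up_log 2 n.+1).

(* A field [b1 ... bm] is written [1 b1 ... 1 bm 0]. *)
Definition delimited (s : seq bool) : seq bool :=
  rcons (flatten [seq [:: true; b] | b <- s]) false.

(* Vertices are numbered 0, ..., n-1. *)
Record sat_instance := SatInstance {
  inst_size : nat;
  inst_game : influence_game 'I_inst_size;
  inst_actor : 'I_inst_size
}.

(* The fields are n, the rows of the adjacency matrix, the numerators and the
   denominators of the labels, the indicator vector of N, q, and i. *)
Definition encode_instance (p : sat_instance) : seq bool :=
  let g := inst_game p in
  let V := enum 'I_(inst_size p) in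
  flatten [seq delimited s | s <-
    binary (inst_size p) ::
    [seq [seq (u, v) \in game_edges g | v <- V] | u <- V] ++
    [seq binary `|numq (label g u)|%N | u <- V] ++
    [seq binary `|denq (label g u)|%N | u <- V] ++
    [:: [seq v \in players g | v <- V];
        binary (quota g); binary (inst_actor p)]].

(* Main.v *)
(* Record for a strong hierarchical graph H the generating function
   sum_X Y^|F(X)| Z^|F(X) & FI(H)|, where X ranges over the sets of sources of H.
   It is multiplicative under disjoint unions, and after adding a layer V' above
   FI(H) the number of active vertices of V' depends only on |F(X) & FI(H)|, so
   that the new function is obtained from the coefficients of the powers of Z.
   The layers can be read off the graph, since a layer consists of all vertices
   with a given nonempty set of predecessors; hence n rounds of a table indexed
   by vertices compute the generating function without any decomposition of the
   graph.  Y and Z are replaced by large powers of 2, which makes a generating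
   function a single binary number.  The satisfaction of i is then read off the
   two functions in which the choice of i is forced to 1, resp. to 0: count
   |F(X)| >= q in the first and |F(X)| < q in the second.

   A Turing machine for this algorithm comes from programs over stack registers
   (one tape per register), which suffice to show that polynomial time is closed
   under composition, pairing, case analysis and polynomially bounded loops on
   binary trees; natural numbers, lists and fields are encoded as trees. *)

Require Import Defs.
From mathcomp Require Import all_boot all_order all_algebra.
From mathcomp Require Import zify.
From Stdlib Require Import FunctionalExtensionality.

Set Implicit Arguments.
Unset Strict Implicit.
Unset Printing Implicit Defensive.

Import Order.TTheory GRing.Theory Num.Theory.

(** * Programs over stack registers *)

(** The recursive construction of a strong hierarchical graph exists only inside the proof; the
    algorithm sees a matrix. Two facts link them. The vertices of FI(H) have no successor in H, so
    the predecessor set FI(H) of a new layer occurs at no vertex of H; and since it is nonempty, it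
    occurs at no vertex of a disjoint part. No order of the layers has to be found: each round
    recomputes all entries, and after t rounds those of layers on top of parts with fewer than t
    vertices are right, whatever the other entries contain. An actor with predecessors needs no
    separate algorithm. Forcing it is void, the outcome does not depend on its bit, and exactly one
    value of that bit agrees with the outcome; the bits of the other vertices with predecessors are
    free and contribute a power of 2. Time bounds have to hold for every bit string, not only for
    encoded instances, so the numbers are kept small without appeal to the structure of the
    graph. *)

Definition memory := nat -> seq bool.

Definition upd (m : memory) (r : nat) (s : seq bool) : memory :=
  fun j => if j == r then s else m j.

Inductive prog :=
| Skip
| Push of nat & bool
| Pop of nat
| Seq of prog & prog
| Case of nat & prog & prog & prog
| Loop of nat & prog.

(* The second argument of [run] is the exact number of Turing machine steps
   of the compiled program. *)
Inductive run : prog -> memory -> nat -> memory -> Prop :=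
| run_skip m : run Skip m 1 m
| run_push r b m : run (Push r b) m 2 (upd m r (b :: m r))
| run_pop r m : run (Pop r) m 1 (upd m r (behead (m r)))
| run_seq p q m1 m2 m3 t1 t2 :
    run p m1 t1 m2 -> run q m2 t2 m3 -> run (Seq p q) m1 (t1 + t2) m3
| run_case r p q s m t m' :
    run (if m r is b :: _ then if b then p else q else s) m t m' ->
    run (Case r p q s) m t.+1 m'
| run_loop_end r p m : m r = [::] -> run (Loop r p) m 1 m
| run_loop r p m1 m2 m3 t1 t2 :
    m1 r <> [::] -> run p m1 t1 m2 -> run (Loop r p) m2 t2 m3 ->
    run (Loop r p) m1 (t1 + t2).+1 m3.

(** A push costs two steps and adds one bit. This turns time bounds into bounds on the size of
    outputs. *)
Lemma run_size p m t m' r : run p m t m' -> size (m' r) <= size (m r) + t.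
Proof.
elim=> {p m t m'} /=.
- by move=> m; lia.
- by move=> r' b m; rewrite /upd; case: eqP => [->|_] /=; lia.
- by move=> r' m; rewrite /upd; case: eqP => [->|_] /=; rewrite ?size_behead; lia.
- by move=> p q m1 m2 m3 t1 t2 _ H1 _ H2; lia.
- by move=> r' p q s m t m' _ H1; lia.
- by move=> r' p m _; lia.
- by move=> r' p m1 m2 m3 t1 t2 _ _ H1 _ H2; lia.
Qed.

Fixpoint max_reg (p : prog) : nat :=
  match p with
  | Skip => 0
  | Push r _ | Pop r => r
  | Seq p q => maxn (max_reg p) (max_reg q)
  | Case r p q s =>
      maxn r (maxn (max_reg p) (maxn (max_reg q) (max_reg s)))
  | Loop r p => maxn r (max_reg p)
  end.

(** * Compilation to Turing machines *)

Section Compile.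
Variable K : nat.

Local Notation tcell := (cell void).
Local Notation ttape := (tape void).
Local Notation tapes := {ffun 'I_K.+1 -> ttape}.
Local Notation action := {ffun 'I_K.+1 -> tcell * move}.
Local Notation reading := {ffun 'I_K.+1 -> tcell}.

Definition bit_cell (b : bool) : tcell := Some (inl b).

Fixpoint st (p : prog) : finType :=
  match p with
  | Skip => unit
  | Push _ _ => bool
  | Pop _ => unit
  | Seq p q => (st p + st q)%type
  | Case _ p q s => option (st p + (st q + st s))%type
  | Loop _ p => option (st p)
  end.

Fixpoint start (p : prog) : st p :=
  match p return st p with
  | Skip => tt
  | Push _ _ => false
  | Pop _ => tt
  | Seq p q => inl (start p)
  | Case _ p q s => None
  | Loop _ p => None
  end.

Definition keep (rd : reading) : action := [ffun k => (rd k, Stay)].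

Definition act_on (rd : reading) (r : nat) (a : tcell * move) : action :=
  [ffun k => if val k == r then a else (rd k, Stay)].

(** The successor [None] means leaving the program, so a program has no halting state of its own and
    can be continued by any other. For a loop, leaving the body is the state [None] of
    [option (st p)], where the register is tested again. A push takes two steps because the head
    must first move to a free cell. *)
Fixpoint delta (p : prog) : st p -> reading -> option (st p) * action :=
  match p return st p -> reading -> option (st p) * action with
  | Skip => fun _ rd => (None, keep rd)
  | Push r b => fun s rd =>
      if s then (None, act_on rd r (bit_cell b, Stay))
      else (Some true, act_on rd r (rd (inord r), MoveLeft))
  | Pop r => fun _ rd => (None, act_on rd r (None, MoveRight))
  | Seq p q => fun s rd =>
      match s with
      | inl s => let: (s', a) := delta s rd in
                 (Some (if s' is Some s' then inl s' else inr (start q)), a)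
      | inr s => let: (s', a) := delta s rd in (omap inr s', a)
      end
  | Case r p q u => fun s rd =>
      match s with
      | None =>
          (Some (Some (match rd (inord r) with
                       | Some (inl true) => inl (start p)
                       | Some (inl false) => inr (inl (start q))
                       | _ => inr (inr (start u))
                       end)), keep rd)
      | Some (inl s) => let: (s', a) := delta s rd in
                        (omap (fun z => Some (inl z)) s', a)
      | Some (inr (inl s)) => let: (s', a) := delta s rd in
                        (omap (fun z => Some (inr (inl z))) s', a)
      | Some (inr (inr s)) => let: (s', a) := delta s rd in
                        (omap (fun z => Some (inr (inr z))) s', a)
      end
  | Loop r p => fun s rd =>
      match s with
      | None => (if rd (inord r) is Some _ then Some (Some (start p)) else None,
                 keep rd)
      | Some s => let: (s', a) := delta s rd in (Some s', a)
      end
  end.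

Definition apply_action (a : action) (T : tapes) : tapes :=
  [ffun k => tape_move (a k).2 (tape_write (a k).1 (T k))].

Definition scan (T : tapes) : reading := [ffun k => tape_read (T k)].

Inductive reach (p : prog) : nat -> option (st p) -> tapes ->
    option (st p) -> tapes -> Prop :=
| reach0 s T : reach 0 s T s T
| reachS n s T s' T' :
    reach n (delta s (scan T)).1 (apply_action (delta s (scan T)).2 T) s' T' ->
    reach n.+1 (Some s) T s' T'.

Lemma reach_trans p n1 n2 s1 T1 s2 T2 s3 T3 :
  @reach p n1 s1 T1 s2 T2 -> @reach p n2 s2 T2 s3 T3 ->
  reach (n1 + n2) s1 T1 s3 T3.
Proof.
elim=> {n1 s1 T1 s2 T2} // n s T s' T' _ IH H3.
by rewrite addSn; apply: reachS; apply: IH.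
Qed.

(** Every control structure runs a part inside its own states. The map [e] embeds the states of the
    part and also says where its exit leads. *)
Lemma reach_embed p q (e : option (st p) -> option (st q)) n s T s' T' :
  (forall s rd, exists2 s1, e (Some s) = Some s1 &
     delta s1 rd = (e (delta s rd).1, (delta s rd).2)) ->
  reach n s T s' T' -> reach n (e s) T (e s') T'.
Proof.
move=> He; elim=> {n s T s' T'} [s T|n s T s' T' _ IH]; first exact: reach0.
have [s1 -> Hd] := He s (scan T).
by apply: reachS; rewrite Hd.
Qed.

(** The head scans the top of the stack, so emptiness shows as a blank cell and no bottom marker is
    needed. The numbers [i] and [j] absorb the blanks that pops leave on the left and that rewriting
    a scanned blank adds on the right. *)
Definition stack_tape (t : ttape) (s : seq bool) : Prop :=
  exists i j, t = (nseq i None, [seq bit_cell b | b <- s] ++ nseq j None).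

Lemma stack_tape_read t s : stack_tape t s ->
  tape_read t = if s is b :: _ then bit_cell b else None.
Proof. by case=> i [j ->]; case: s => [|b s] //=; case: j. Qed.

Lemma stack_tape_keep t s : stack_tape t s ->
  stack_tape (tape_move Stay (tape_write (tape_read t) t)) s.
Proof.
case=> i [j ->]; case: s => [|b s]; last by exists i, j.
by case: j => [|j]; exists i; [exists 1|exists j.+1].
Qed.

Lemma stack_tape_pop t s : stack_tape t s ->
  stack_tape (tape_move MoveRight (tape_write None t)) (behead s).
Proof.
case=> i [j ->]; exists i.+1; case: s => [|b s]; last by exists j.
by exists j.-1; case: j.
Qed.

Lemma stack_tape_push t s b : stack_tape t s ->
  stack_tape (tape_write (bit_cell b)
    (tape_move MoveLeft (tape_write (tape_read t) t))) (b :: s).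
Proof.
case=> i [j ->]; exists i.-1; case: s => [|c s]; last by exists j; case: i.
by exists j.-1.+1; case: i; case: j.
Qed.

Definition represents (T : tapes) (m : memory) : Prop :=
  forall k : 'I_K.+1, stack_tape (T k) (m k).

Lemma represents_keep T m : represents T m ->
  represents (apply_action (keep (scan T)) T) m.
Proof. by move=> H k; rewrite !ffunE /=; apply: stack_tape_keep. Qed.

Lemma scan_reg T m r : represents T m -> r <= K ->
  scan T (inord r) = if m r is b :: _ then bit_cell b else None.
Proof. by move=> H le_rK; rewrite ffunE (stack_tape_read (H _)) inordK. Qed.

Lemma apply_act_onE T r a k :
  apply_action (act_on (scan T) r a) T k =
  if val k == r then tape_move a.2 (tape_write a.1 (T k))
  else tape_move Stay (tape_write (tape_read (T k)) (T k)).
Proof. by rewrite !ffunE; case: eqP. Qed.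

Lemma represents_pop T m r : represents T m ->
  represents (apply_action (act_on (scan T) r (None, MoveRight)) T)
    (upd m r (behead (m r))).
Proof.
move=> H k; rewrite apply_act_onE /upd.
by have [<-|_] := eqVneq; [apply: stack_tape_pop | apply: stack_tape_keep].
Qed.

Lemma represents_push T m r b : represents T m -> r <= K ->
  let T1 := apply_action (act_on (scan T) r (scan T (inord r), MoveLeft)) T in
  represents (apply_action (act_on (scan T1) r (bit_cell b, Stay)) T1)
    (upd m r (b :: m r)).
Proof.
move=> H le_rK T1 k; rewrite apply_act_onE /T1 !apply_act_onE /upd.
have [Ek|_] := eqVneq; last by do 2!apply: stack_tape_keep.
have Er : inord r = k by apply: val_inj; rewrite /= inordK.
by rewrite Er ffunE -Ek; apply: stack_tape_push.
Qed.

Theorem run_reach p m t m' : run p m t m' -> max_reg p <= K ->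
  forall T, represents T m ->
  exists2 T', represents T' m' & reach t (Some (start p)) T None T'.
Proof.
elim=> {p m t m'} /=.
- move=> m _ T H; eexists; last by apply: reachS; apply: reach0.
  exact: represents_keep.
- move=> r b m le_rK T H.
  exists (let T1 := apply_action (act_on (scan T) r (scan T (inord r), MoveLeft)) T in
    apply_action (act_on (scan T1) r (bit_cell b, Stay)) T1).
    exact: represents_push.
  by apply: reachS; apply: reachS; apply: reach0.
- move=> r m _ T H; eexists; last by apply: reachS; apply: reach0.
  exact: represents_pop.
- move=> p q m1 m2 m3 t1 t2 _ IH1 _ IH2 le_K T H.
  move: le_K; rewrite geq_max => /andP[/IH1/(_ T H)[T1 H1 R1] /IH2/(_ T1 H1)[T2 H2 R2]].
  exists T2 => //; apply: (@reach_trans (Seq p q) t1 t2 _ _ (Some (inr (start q))) T1).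
  + refine (@reach_embed p (Seq p q)
      (fun s => Some (if s is Some s' then inl s' else inr (start q)))
      _ _ _ _ _ _ R1).
    by move=> s rd; exists (inl s) => //=; case: (delta s rd).
  + refine (@reach_embed q (Seq p q) (omap inr) _ _ _ _ _ _ R2).
    by move=> s rd; exists (inr s) => //=; case: (delta s rd).
- move=> r p q u m t m' _ IH; rewrite !geq_max => /and4P[le_rK le_p le_q le_u] T H.
  have le_K : max_reg (if m r is b :: _ then if b then p else q else u) <= K.
    by case: (m r) => [|[] ?].
  have [T1 H1 R1] := IH le_K _ (represents_keep H).
  exists T1 => //; apply: reachS => /=.
  rewrite (scan_reg H le_rK).
  case: (m r) R1 => [|[] ?] /= R1.
  + refine (@reach_embed u (Case r p q u)
      (fun s => omap (fun z => Some (inr (inr z))) s) _ _ _ _ _ _ R1).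
    by move=> s rd; exists (Some (inr (inr s))) => //=; case: (delta s rd).
  + refine (@reach_embed p (Case r p q u)
      (fun s => omap (fun z => Some (inl z)) s) _ _ _ _ _ _ R1).
    by move=> s rd; exists (Some (inl s)) => //=; case: (delta s rd).
  + refine (@reach_embed q (Case r p q u)
      (fun s => omap (fun z => Some (inr (inl z))) s) _ _ _ _ _ _ R1).
    by move=> s rd; exists (Some (inr (inl s))) => //=; case: (delta s rd).
- move=> r p m mr0; rewrite geq_max => /andP[le_rK le_p] T H.
  exists (apply_action (keep (scan T)) T); first exact: represents_keep.
  by apply: reachS; rewrite /= (scan_reg H le_rK) mr0; apply: reach0.
- move=> r p m1 m2 m3 t1 t2 mr _ IH1 _ IH2 le_K T H.
  move: (le_K); rewrite geq_max => /andP[le_rK le_p].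
  have [T1 H1 R1] := IH1 le_p _ (represents_keep H).
  have [T2 H2 R2] := IH2 le_K _ H1.
  exists T2 => //; apply: reachS; rewrite /= (scan_reg H le_rK).
  case: (m1 r) mr => [|b s] //= _.
  apply: (@reach_trans (Loop r p) t1 t2 _ _ (Some None) T1) => //.
  refine (@reach_embed p (Loop r p) (fun s => Some s) _ _ _ _ _ _ R1).
  by move=> s0 rd; exists (Some s0) => //=; case: (delta s0 rd).
Qed.

End Compile.

Definition machine (p : prog) : turing_machine :=
  @TuringMachine (option (st p)) void (max_reg p) (Some (start p)) (pred1 None)
    (fun s rd => if s is Some s then delta s rd else (None, keep rd)).

Lemma iter_tm_step_reach p n s T s' T' : @reach (max_reg p) p n s T s' T' ->
  iter n (@tm_step (machine p)) (s, T) = (s', T').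
Proof.
elim=> {n s T s' T'} // n s T s' T' _ IH.
rewrite iterSr {2}/tm_step /= -[RHS]IH; congr (iter n _ _).
by case: (delta s (scan T)).
Qed.

Definition input_mem (w : seq bool) : memory := upd (fun _ => [::]) 0 w.

Lemma leading_bits_stack (s : seq bool) j :
  leading_bits ([seq @bit_cell b | b <- s] ++ nseq j None) = s.
Proof. by elim: s => [|b s /= ->] //; case: j. Qed.

Theorem machine_computes p w t m' n : run p (input_mem w) t m' -> t <= n ->
  tm_computes_within (machine p) w n (m' 0).
Proof.
move=> Hr le_tn.
have H0 : represents (tm_init (machine p) w).2 (input_mem w).
  move=> k; rewrite ffunE; exists 0, 0; rewrite /input_mem /upd.
  by have -> : (k == ord0) = (val k == 0) by []; case: eqP => //; rewrite cats0.
have [T' H' R'] := run_reach Hr (leqnn _) H0.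
have E := iter_tm_step_reach R'.
rewrite /tm_computes_within -(subnK le_tn) iterD [iter t _ _]E.
rewrite iter_fix //=; split=> //.
by rewrite /tm_output /=; have [i [j ->]] := H' ord0; rewrite /= leading_bits_stack.
Qed.

(** * Polynomial-time functions on binary trees *)

(** Time is bounded only from above, so that costs can be padded to closed formulas in the sizes of
    the registers. *)
Definition does (p : prog) (m : memory) (T : nat) (m' : memory) : Prop :=
  exists2 t, t <= T & run p m t m'.

Lemma does_seq p q m1 T1 m2 T2 m3 :
  does p m1 T1 m2 -> does q m2 T2 m3 -> does (Seq p q) m1 (T1 + T2) m3.
Proof.
by case=> t1 le1 r1 [t2 le2 r2]; exists (t1 + t2); [lia | apply: run_seq r1 r2].
Qed.

Lemma does_le p m T T' m' : T <= T' -> does p m T m' -> does p m T' m'.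
Proof. by move=> le_T [t le_t r]; exists t => //; lia. Qed.

Lemma does_case r p q s m T m' :
  does (if m r is b :: _ then if b then p else q else s) m T m' ->
  does (Case r p q s) m T.+1 m'.
Proof. by case=> t le_t H; exists t.+1 => //; apply: run_case. Qed.

Lemma does_loop_end r p m : m r = [::] -> does (Loop r p) m 1 m.
Proof. by exists 1 => //; apply: run_loop_end. Qed.

Lemma does_loop r p m1 m2 m3 T1 T2 : m1 r <> [::] ->
  does p m1 T1 m2 -> does (Loop r p) m2 T2 m3 ->
  does (Loop r p) m1 (T1 + T2).+1 m3.
Proof.
by move=> h [t1 le1 r1] [t2 le2 r2]; exists (t1 + t2).+1;
  [lia | apply: run_loop r1 r2].
Qed.

(* A subprogram owns the registers from k on and preserves those below; the
   registers beyond the list l are empty. *)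
Definition layout (m : memory) (k : nat) (l : seq (seq bool)) : memory :=
  fun j => if j < k then m j else nth [::] l (j - k).

Lemma layoutE m k l i : layout m k l (k + i) = nth [::] l i.
Proof. by rewrite /layout ltnNge leq_addr addKn. Qed.

Lemma upd_layout m k l i s :
  upd (layout m k l) (k + i) s = layout m k (set_nth [::] l i s).
Proof.
apply: functional_extensionality => j; rewrite /upd /layout nth_set_nth /=.
have [->|ne_j] := eqVneq; first by rewrite ltnNge leq_addr addKn /= eqxx.
by case: ltnP => // le_kj; rewrite ifN //; lia.
Qed.

(** The first owned register is handed over to the preserved memory, so that a subprogram based at a
    later register can be called. *)
Lemma layout_shift m k s l :
  layout m k (s :: l) = layout (layout m k [:: s]) (k + 1) l.
Proof.
apply: functional_extensionality => j; rewrite /layout.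
case: ltnP => h1; case: ltnP => h2 //; try lia.
  by have -> : j - k = 0 by lia.
by have -> : j - k = (j - (k + 1)).+1 by lia.
Qed.

Lemma layout_shift2 m k s1 s2 l : layout m k [:: s1, s2 & l] =
  layout (layout (layout m k [:: s1]) (k + 1) [:: s2]) (k + 2) l.
Proof. by rewrite 2!layout_shift -addnA. Qed.

(** An empty last register is the same as clean scratch space; this discards temporaries. *)
Lemma layout_rcons m k l : layout m k (rcons l [::]) = layout m k l.
Proof.
apply: functional_extensionality => j; rewrite /layout nth_rcons.
by case: ltnP => // _; case: ltngtP => // h; rewrite nth_default // ?h // ltnW.
Qed.

(** * Clearing and moving registers *)

Section Macros.
Variables (m : memory) (k : nat).

Lemma does_push l i b : does (Push (k + i) b) (layout m k l) 2
  (layout m k (set_nth [::] l i (b :: nth [::] l i))).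
Proof.
by exists 2 => //; rewrite -upd_layout -(layoutE m k); apply: run_push.
Qed.

Lemma does_pop l i : does (Pop (k + i)) (layout m k l) 1
  (layout m k (set_nth [::] l i (behead (nth [::] l i)))).
Proof.
by exists 1 => //; rewrite -upd_layout -(layoutE m k); apply: run_pop.
Qed.

Lemma set_nth_same (l : seq (seq bool)) i s : i < size l ->
  nth [::] l i = s -> set_nth [::] l i s = l.
Proof.
move=> lt_i E; apply: (@eq_from_nth _ [::]).
  by rewrite size_set_nth; apply/maxn_idPr.
by move=> j _; rewrite nth_set_nth /=; case: eqP => [->|].
Qed.

Definition clear r := Loop r (Pop r).

Lemma does_clear l i : i < size l ->
  does (clear (k + i)) (layout m k l) (2 * size (nth [::] l i)).+1
    (layout m k (set_nth [::] l i [::])).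
Proof.
move Es: (nth [::] l i) => s; elim: s l Es => [|b s IH] l Es lt_i.
  by rewrite set_nth_same // muln0; apply: does_loop_end; rewrite layoutE.
have -> : (2 * size (b :: s)).+1 = (1 + (2 * size s).+1).+1 by rewrite /=; lia.
apply: does_loop (does_pop _ _) _; first by rewrite layoutE Es.
set l' := set_nth _ _ _ _.
have -> : set_nth [::] l i [::] = set_nth [::] l' i [::].
  by rewrite set_set_nth eqxx.
apply: IH; first by rewrite nth_set_nth /= eqxx Es.
by rewrite size_set_nth; lia.
Qed.

Definition transfer r s := Loop r
  (Case r (Seq (Push s true) (Pop r)) (Seq (Push s false) (Pop r)) Skip).

Lemma does_transfer l i j : i < size l -> i != j ->
  does (transfer (k + i) (k + j)) (layout m k l)
    (5 * size (nth [::] l i)).+1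
    (layout m k (set_nth [::] (set_nth [::] l j
       (catrev (nth [::] l i) (nth [::] l j))) i [::])).
Proof.
move Es: (nth [::] l i) => s; elim: s l Es => [|b s IH] l Es lt_i ne_ij.
  have -> : layout m k (set_nth [::] (set_nth [::] l j (catrev [::] (nth [::] l j))) i [::])
     = layout m k l.
    apply: functional_extensionality => r; rewrite /layout !nth_set_nth /= !nth_set_nth /=.
    by case: ltnP => // _; case: eqP => [->|_] //; case: eqP => [->|].
  by rewrite muln0; apply: does_loop_end; rewrite layoutE.
have -> : (5 * size (b :: s)).+1 = (4 + (5 * size s).+1).+1 by rewrite /=; lia.
set l' := set_nth [::] (set_nth [::] l j (b :: nth [::] l j)) i s.
apply: (@does_loop _ _ _ (layout m k l')).
- by rewrite layoutE Es.
- apply: does_case; rewrite layoutE Es.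
  have H c : does (Seq (Push (k + j) c) (Pop (k + i))) (layout m k l) 3
    (layout m k (set_nth [::] (set_nth [::] l j (c :: nth [::] l j)) i s)).
    apply: does_seq (does_push _ _ _) _.
    set l1 := set_nth _ _ _ _.
    have -> : s = behead (nth [::] l1 i).
      by rewrite nth_set_nth /= (negbTE ne_ij) Es.
    exact: does_pop.
  by case: b {Es} @l' => /=; apply: H.
- have -> : set_nth [::] (set_nth [::] l j (catrev (b :: s) (nth [::] l j))) i [::]
     = set_nth [::] (set_nth [::] l' j (catrev s (nth [::] l' j))) i [::].
    rewrite nth_set_nth /= eq_sym (negbTE ne_ij) nth_set_nth /= eqxx.
    rewrite {}/l'; apply: (@eq_from_nth _ [::]).
      by rewrite !size_set_nth; lia.
    move=> r _; rewrite !nth_set_nth /=; have [//|/negbTE r_i] := eqVneq r i.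
    rewrite !nth_set_nth /=; have [//|/negbTE r_j] := eqVneq r j.
    by rewrite nth_set_nth /= r_i nth_set_nth /= r_j.
  apply: IH => //; first by rewrite nth_set_nth /= eqxx.
  by rewrite !size_set_nth; lia.
Qed.

End Macros.

(** * Binary trees, their codes and polynomial bounds *)

Inductive tree := Leaf | Node of tree & tree.

Fixpoint tsize (x : tree) : nat :=
  if x is Node y z then (tsize y + tsize z).+1 else 1.

(** A prefix code: the end of a tree is recognised from its bits, so pairs need no separator. *)
Fixpoint code (x : tree) : seq bool :=
  if x is Node y z then true :: code y ++ code z else [:: false].

Lemma size_code x : size (code x) = tsize x.
Proof. by elim: x => //= y IHy z IHz; rewrite size_cat IHy IHz. Qed.

Lemma tsize_gt0 x : 0 < tsize x.
Proof. by case: x. Qed.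

Lemma leq_wexp2r m n e : m <= n -> m ^ e <= n ^ e.
Proof. by case: e => // e le_mn; rewrite leq_exp2r. Qed.

(** A monomial suffices because [tsize] is positive, so that constants and lower powers are
    absorbed. *)
Definition poly_bounded (I : Type) (x : I -> tree) (F : I -> nat) : Prop :=
  exists c d, forall i, F i <= c * tsize (x i) ^ d.

Section PolyBounded.
Variables (I : Type) (x : I -> tree).

Lemma poly_bounded_le F G :
  (forall i, F i <= G i) -> poly_bounded x G -> poly_bounded x F.
Proof.
by move=> le_FG [c [d H]]; exists c, d => i; apply: leq_trans (le_FG i) (H i).
Qed.

Lemma poly_bounded_const c : poly_bounded x (fun _ => c).
Proof. by exists c, 0 => i; rewrite expn0 muln1. Qed.

Lemma poly_bounded_size : poly_bounded x (fun i => tsize (x i)).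
Proof. by exists 1, 1 => i; rewrite expn1 mul1n. Qed.

Lemma poly_bounded_add F G : poly_bounded x F -> poly_bounded x G ->
  poly_bounded x (fun i => F i + G i).
Proof.
move=> [c [d HF]] [c' [d' HG]]; exists (c + c'), (d + d') => i.
have x0 := tsize_gt0 (x i); rewrite mulnDl expnD.
apply: leq_add; [apply: leq_trans (HF i) _ | apply: leq_trans (HG i) _].
  by rewrite leq_mul2l leq_pmulr ?orbT // expn_gt0 x0.
by rewrite leq_mul2l leq_pmull ?orbT // expn_gt0 x0.
Qed.

Lemma poly_bounded_mul F G : poly_bounded x F -> poly_bounded x G ->
  poly_bounded x (fun i => F i * G i).
Proof.
move=> [c [d HF]] [c' [d' HG]]; exists (c * c'), (d + d') => i.
by rewrite expnD mulnACA; apply: leq_mul.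
Qed.

Lemma poly_bounded_exp F d : poly_bounded x F ->
  poly_bounded x (fun i => F i ^ d).
Proof.
move=> HF; elim: d => [|d IH]; first exact: poly_bounded_const.
apply: (@poly_bounded_le _ (fun i => F i * F i ^ d)).
  by move=> i; rewrite expnS.
exact: poly_bounded_mul.
Qed.

Lemma poly_bounded_comp (y : I -> tree) F :
  poly_bounded x (fun i => tsize (y i)) -> poly_bounded y F -> poly_bounded x F.
Proof.
move=> Hy [c [d HF]]; apply: poly_bounded_le HF _.
apply: poly_bounded_mul; first exact: poly_bounded_const.
exact: poly_bounded_exp.
Qed.

End PolyBounded.

Lemma poly_bounded_reindex I J (phi : J -> I) (x : I -> tree) F :
  poly_bounded x F -> poly_bounded (x \o phi) (F \o phi).
Proof. by case=> c [d H]; exists c, d => j; apply: H. Qed.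

(* The program works in place on register k, with the later registers as clean
   scratch space.  Quantifying over families indexed by I rather than over all
   trees lets the body of a loop assume an invariant. *)
Definition polytime (I : Type) (x y : I -> tree) : Prop :=
  forall k, exists (p : prog) (F : I -> nat), poly_bounded x F /\
    forall i m, does p (layout m k [:: code (x i)]) (F i)
                       (layout m k [:: code (y i)]).

(** A program cannot write more bits than it makes steps. Composition relies on this: the second
    time bound is in terms of the intermediate value. *)
Lemma polytime_size I (x y : I -> tree) : polytime x y ->
  poly_bounded x (fun i => tsize (y i)).
Proof.
move=> /(_ 0)[p [F [HF H]]].
apply: (@poly_bounded_le _ _ _ (fun i => tsize (x i) + F i)); last first.
  by apply: poly_bounded_add => //; apply: poly_bounded_size.
move=> i; have [t le_t /(run_size 0)] := H i (fun _ => [::]).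
by rewrite /layout /= !size_code; lia.
Qed.

Lemma polytime_reindex I J (x y : I -> tree) (x' y' : J -> tree) :
  (forall j, exists i, x' j = x i /\ y' j = y i) ->
  polytime x y -> polytime x' y'.
Proof.
move=> Hij H k; have [p [F [[c [d HF]] Hp]]] := H k.
(* The bound is phrased through the size of [x' j], because the hypothesis gives no function
   choosing [i] from [j]. *)
exists p, (fun j => c * tsize (x' j) ^ d); split; first by exists c, d.
move=> j m; have [i [-> ->]] := Hij j.
by apply: does_le (HF i) _; apply: Hp.
Qed.

Lemma polytime_id I (x : I -> tree) : polytime x x.
Proof.
move=> k; exists Skip, (fun _ => 1); split; first exact: poly_bounded_const.
by move=> i m; exists 1 => //; apply: run_skip.
Qed.

Lemma polytime_ext I (x y z : I -> tree) :
  (forall i, y i = z i) -> polytime x y -> polytime x z.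
Proof. by move=> E; apply: polytime_reindex => i; exists i. Qed.

Lemma polytime_comp I (x y z : I -> tree) :
  polytime x y -> polytime y z -> polytime x z.
Proof.
move=> Hxy Hyz k; have [p [F [HF Hp]]] := Hxy k; have [q [G [HG Hq]]] := Hyz k.
exists (Seq p q), (fun i => F i + G i); split.
  by apply: poly_bounded_add => //; apply: poly_bounded_comp HG; apply: polytime_size.
by move=> i m; apply: does_seq.
Qed.

Definition push_all r (s : seq bool) : prog :=
  foldr (fun b p => Seq p (Push r b)) Skip s.

Lemma does_push_all m k l i s : does (push_all (k + i) s) (layout m k l)
  (2 * size s).+1 (layout m k (set_nth [::] l i (s ++ nth [::] l i))).
Proof.
elim: s => [|b s IH] /=.
  have -> : layout m k (set_nth [::] l i (nth [::] l i)) = layout m k l.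
    by rewrite -upd_layout; apply: functional_extensionality => j; rewrite /upd;
       case: eqP => [->|//]; rewrite layoutE.
  by exists 1 => //; apply: run_skip.
have -> : (2 * (size s).+1).+1 = (2 * size s).+1 + 2 by lia.
apply: does_seq IH _.
set l1 := set_nth [::] l i (s ++ _).
have -> : set_nth [::] l i (b :: s ++ nth [::] l i)
  = set_nth [::] l1 i (b :: nth [::] l1 i).
  by rewrite nth_set_nth /= eqxx set_set_nth eqxx.
exact: does_push.
Qed.

Lemma polytime_const I (x : I -> tree) (c : tree) : polytime x (fun _ => c).
Proof.
move=> k; exists (Seq (clear (k + 0)) (push_all (k + 0) (code c))).
exists (fun i => (2 * tsize (x i)).+1 + (2 * size (code c)).+1); split.
  apply: poly_bounded_add; last exact: poly_bounded_const.
  apply: (@poly_bounded_le _ _ _ (fun i => 2 * tsize (x i) + 1)) => [i|]; first lia.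
  apply: poly_bounded_add; last exact: poly_bounded_const.
  by apply: poly_bounded_mul; [exact: poly_bounded_const|exact: poly_bounded_size].
move=> i m; apply: does_seq.
  by rewrite -size_code; apply: (@does_clear m k [:: code (x i)] 0).
by have := @does_push_all m k [:: [::]] 0 (code c); rewrite /= cats0.
Qed.

Ltac pbound :=
  repeat first
    [ exact: poly_bounded_const | exact: poly_bounded_size | assumption
    | apply: poly_bounded_add | apply: poly_bounded_mul | apply: poly_bounded_exp ].

(** A single transfer reverses the bits; the second one, out of the scratch register [t], restores
    their order. *)
Definition move3 r s t := Seq (transfer r t) (transfer t s).

Lemma does_move3 m k l i j h : i < size l -> i != j -> i != h -> j != h ->
  nth [::] l j = [::] -> nth [::] l h = [::] ->
  does (move3 (k + i) (k + j) (k + h)) (layout m k l)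
    (10 * size (nth [::] l i) + 2)
    (layout m k (set_nth [::] (set_nth [::] l j (nth [::] l i)) i [::])).
Proof.
move=> lt_i ne_ij ne_ih ne_jh lj0 lh0.
have -> : 10 * size (nth [::] l i) + 2 =
  (5 * size (nth [::] l i)).+1 + (5 * size (nth [::] l i)).+1 by lia.
apply: does_seq (does_transfer _ _ lt_i ne_ih) _.
set l1 := set_nth _ _ _ _.
have l1h : nth [::] l1 h = rev (nth [::] l i).
  by rewrite /l1 nth_set_nth /= eq_sym (negbTE ne_ih) nth_set_nth /= eqxx lh0.
have l1j : nth [::] l1 j = [::].
  rewrite /l1 nth_set_nth /= eq_sym (negbTE ne_ij) nth_set_nth /= (negbTE ne_jh).
  exact: lj0.
have -> : layout m k (set_nth [::] (set_nth [::] l j (nth [::] l i)) i [::]) =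
  layout m k (set_nth [::] (set_nth [::] l1 j
    (catrev (nth [::] l1 h) (nth [::] l1 j))) h [::]).
  apply: functional_extensionality => r; rewrite /layout; case: ltnP => // _.
  rewrite l1h l1j catrevE revK cats0 !nth_set_nth /= !nth_set_nth /= /l1.
  rewrite !nth_set_nth /= !nth_set_nth /=.
  have [->|ri] := eqVneq (r - k) i; first by rewrite (negbTE ne_ih) (negbTE ne_ij).
  have [->|rj] := eqVneq (r - k) j; first by rewrite (negbTE ne_jh).
  by have [->|] := eqVneq (r - k) h.
rewrite -[in X in does _ _ X](size_rev (nth [::] l i)) -l1h.
apply: does_transfer; last by rewrite eq_sym.
by rewrite /l1 !size_set_nth; lia.
Qed.

Definition transfer2 r s t := Loop r
  (Case r (Seq (Push s true) (Seq (Push t true) (Pop r)))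
          (Seq (Push s false) (Seq (Push t false) (Pop r))) Skip).

Lemma does_transfer2 m k s1 s2 s3 :
  does (transfer2 (k + 2) (k + 0) (k + 1)) (layout m k [:: s1; s2; s3])
    (7 * size s3).+1
    (layout m k [:: catrev s3 s1; catrev s3 s2; [::]]).
Proof.
elim: s3 s1 s2 => [|b s IH] s1 s2.
  by rewrite muln0; apply: does_loop_end; rewrite layoutE.
have -> : (7 * size (b :: s)).+1 = (6 + (7 * size s).+1).+1 by rewrite /=; lia.
apply: (@does_loop _ _ _ (layout m k [:: b :: s1; b :: s2; s])).
- by rewrite layoutE.
- apply: does_case; rewrite layoutE /=.
  have H c : does (Seq (Push (k + 0) c) (Seq (Push (k + 1) c) (Pop (k + 2))))
    (layout m k [:: s1; s2; b :: s]) (2 + (2 + 1))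
    (layout m k [:: c :: s1; c :: s2; s]).
    apply: does_seq (does_push _ _ _ _ _) _.
    apply: does_seq (does_push _ _ _ _ _) _.
    exact: (does_pop m k [:: c :: s1; c :: s2; b :: s] 2).
  by case: b H => H; apply: H.
- exact: IH.
Qed.

(** Both programs work in place, so the input is duplicated first. The second component is computed
    first, since it ends up lower on the stack. *)
Lemma polytime_node I (x y z : I -> tree) :
  polytime x y -> polytime x z -> polytime x (fun i => Node (y i) (z i)).
Proof.
move=> Hy Hz k.
have [p [F [HF Hp]]] := Hy (k + 2); have [q [G [HG Hq]]] := Hz (k + 1).
exists (Seq (transfer (k + 0) (k + 2)) (Seq (transfer2 (k + 2) (k + 0) (k + 1))
  (Seq q (Seq (move3 (k + 0) (k + 2) (k + 3)) (Seq p
  (Seq (move3 (k + 1) (k + 0) (k + 3)) (Seq (transfer (k + 2) (k + 3))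
  (Seq (transfer (k + 3) (k + 0)) (Push (k + 0) true))))))))).
exists (fun i => (5 * tsize (x i) + 1) + ((7 * tsize (x i) + 1) + (G i +
  ((10 * tsize (x i) + 2) + (F i + ((10 * tsize (z i) + 2) +
  ((5 * tsize (y i) + 1) + ((5 * tsize (y i) + 1) + 2)))))))); split.
  have := polytime_size Hy; have := polytime_size Hz => *; pbound.
move=> i m; set X := code (x i); set Y := code (y i); set Z := code (z i).
rewrite -!size_code -/X -/Y -/Z ![_ * _ + 1]addn1.
apply: does_seq (does_transfer m k (l := [:: X]) (i := 0) (j := 2) _ _) _ => //=.
rewrite -{1}(size_rev X).
apply: does_seq (does_transfer2 m k [::] [::] (rev X)) _.
rewrite !catrevE !revK !cats0 (layout_rcons m k [:: X; X]).
apply: (@does_seq _ _ _ _ (layout m k [:: X; Z])).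
  by rewrite (layout_shift m k X [:: X]) (layout_shift m k X [:: Z]); apply: Hq.
apply: does_seq (@does_move3 m k [:: X; Z] 0 2 3 _ _ _ _ _ _) _ => //=.
apply: (@does_seq _ _ _ _ (layout m k [:: [::]; Z; Y])).
  by rewrite !layout_shift2; apply: Hp.
apply: does_seq (@does_move3 m k [:: [::]; Z; Y] 1 0 3 _ _ _ _ _ _) _ => //=.
apply: does_seq (does_transfer m k (l := [:: Z; [::]; Y]) (i := 2) (j := 3) _ _) _ => //=.
rewrite -{1}(size_rev Y).
apply: does_seq (does_transfer m k (l := [:: Z; [::]; [::]; rev Y]) (i := 3) (j := 0) _ _) _ => //=.
rewrite catrevE revK.
have := does_push m k [:: Y ++ Z; [::]; [::]; [::]] 0 true.
rewrite (layout_rcons m k [:: Y ++ Z; [::]; [::]]) /=.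
rewrite (layout_rcons m k [:: true :: Y ++ Z; [::]; [::]]).
by rewrite (layout_rcons m k [:: true :: Y ++ Z; [::]]) (layout_rcons m k [:: true :: Y ++ Z]).
Qed.

(* The height of the stack z is the number of subtrees still to be read. *)
Definition scan_tree r s z := Seq (Push z true)
  (Loop z (Case r (Seq (Pop r) (Seq (Push s true) (Push z true)))
                  (Seq (Pop r) (Seq (Push s false) (Pop z))) Skip)).

Lemma does_scan_tree m k (x : tree) w :
  does (scan_tree (k + 0) (k + 1) (k + 2)) (layout m k [:: code x ++ w])
    (2 + (7 * tsize x).+1) (layout m k [:: w; rev (code x)]).
Proof.
rewrite /scan_tree; set L := Loop _ _.
have main s c m' T : does L (layout m k [:: w; catrev (code x) s; c]) T m' ->
  does L (layout m k [:: code x ++ w; s; true :: c]) (7 * tsize x + T) m'.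
  elim: x w s c T => [|y IHy z IHz] w' s c T H /=.
    apply: (@does_le _ _ (5 + T).+1); first lia.
    apply: does_loop H; first by rewrite layoutE.
    apply: does_case; rewrite layoutE /=.
    apply: does_seq (does_pop _ _ _ _) _; apply: (@does_seq _ _ _ 2 _ 1 _) => /=.
      exact: does_push.
    exact: (does_pop m k [:: w'; false :: s; true :: c] 2).
  apply: (@does_le _ _ (6 + (7 * tsize y + (7 * tsize z + T))).+1); first lia.
  apply: (@does_loop _ _ _ (layout m k [:: code y ++ code z ++ w'; true :: s; true :: true :: c])).
  - by rewrite layoutE.
  - apply: does_case; rewrite layoutE /= -catA.
    apply: (@does_seq _ _ _ 1 _ 4); first exact: does_pop.
    apply: (@does_seq _ _ _ 2 _ 2); first exact: does_push.
    exact: (does_push m k [:: code y ++ code z ++ w'; true :: s; true :: c] 2).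
  - by apply: IHy; apply: IHz; move: H; rewrite /= catrev_catl.
apply: does_seq (does_push m k [:: code x ++ w] 2 true) _.
rewrite /= -addn1; apply: main.
rewrite -/(rev _) (layout_rcons m k [:: w; rev (code x)]).
by apply: does_loop_end; rewrite layoutE.
Qed.

Lemma polytime_car I (y z : I -> tree) :
  polytime (fun i => Node (y i) (z i)) y.
Proof.
move=> k; exists (Seq (Pop (k + 0)) (Seq (scan_tree (k + 0) (k + 1) (k + 2))
  (Seq (clear (k + 0)) (transfer (k + 1) (k + 0))))).
exists (fun i => 1 + ((2 + (7 * tsize (y i)).+1) +
  ((2 * tsize (z i)).+1 + (5 * tsize (y i)).+1))); split.
  apply: (@poly_bounded_le _ _ _ (fun i => 14 * tsize (Node (y i) (z i)))).
    by move=> i /=; lia.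
  by apply: poly_bounded_mul; [exact: poly_bounded_const|exact: poly_bounded_size].
move=> i m; apply: does_seq (does_pop _ _ _ _) _.
apply: does_seq (does_scan_tree _ _ _ _) _; rewrite -!size_code.
apply: does_seq (does_clear m k (i := 0) _) _ => //=.
rewrite -(size_rev (code (y i))).
have := @does_transfer m k [:: [::]; rev (code (y i))] 1 0 isT isT.
by rewrite /= catrevE revK cats0 (layout_rcons m k [:: code (y i)]).
Qed.

Lemma polytime_cdr I (y z : I -> tree) :
  polytime (fun i => Node (y i) (z i)) z.
Proof.
move=> k; exists (Seq (Pop (k + 0)) (Seq (scan_tree (k + 0) (k + 1) (k + 2))
  (clear (k + 1)))).
exists (fun i => 1 + ((2 + (7 * tsize (y i)).+1) + (2 * tsize (y i)).+1)); split.
  apply: (@poly_bounded_le _ _ _ (fun i => 14 * tsize (Node (y i) (z i)))).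
    by move=> i /=; have := tsize_gt0 (z i); lia.
  by apply: poly_bounded_mul; [exact: poly_bounded_const|exact: poly_bounded_size].
move=> i m; apply: does_seq (does_pop _ _ _ _) _.
apply: does_seq (does_scan_tree _ _ _ _) _; rewrite -!size_code.
have := @does_clear m k [:: code (z i); rev (code (y i))] 1 isT.
by rewrite /= (layout_rcons m k [:: code (z i)]) size_rev.
Qed.

(** The index types of the branches record the outcome of the test, so each branch has to be correct
    only where it is taken. In the second branch the tested value stays available, paired with the
    input. *)
Lemma polytime_case I (x l o : I -> tree) :
  polytime x l ->
  polytime (fun i : {i | l i = Leaf} => x (sval i)) (fun i => o (sval i)) ->
  polytime (fun i : {i | l i <> Leaf} => Node (l (sval i)) (x (sval i)))
    (fun i => o (sval i)) ->
  polytime x o.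
Proof.
move=> Hl Hleaf Hnode.
apply: polytime_comp (polytime_node Hl (@polytime_id _ x)) _ => k.
have [p [F [[c [d HF]] Hp]]] := Hleaf k.
have [q [G [[c' [d' HG]] Hq]]] := Hnode k.
exists (Seq (Pop (k + 0)) (Case (k + 0) (Seq (Push (k + 0) true) q)
                                        (Seq (Pop (k + 0)) p) Skip)).
pose X i := Node (l i) (x i).
exists (fun i => 1 + (2 + c * tsize (X i) ^ d + c' * tsize (X i) ^ d').+1); split.
  apply: (@poly_bounded_le _ _ _
    (fun i => 4 + (c * tsize (X i) ^ d + c' * tsize (X i) ^ d'))).
    by move=> i; lia.
  pbound.
move=> i m; apply: does_seq (does_pop _ _ _ _) _.
apply: does_case; rewrite layoutE /=.
case El: (l i) => [|a b] /=.
  apply: (@does_le _ _ (1 + c * tsize (x i) ^ d)).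
    apply: leq_trans (leq_addr _ _); rewrite leq_add // leq_mul // leq_wexp2r //.
    by rewrite /=; lia.
  apply: does_seq (does_pop _ _ _ _) _ => /=.
  by have := Hp (exist _ i El) m => /(does_le (HF _)).
have ne : l i <> Leaf by rewrite El.
apply: (@does_le _ _ (2 + c' * tsize (X i) ^ d')).
  by rewrite /X El -addnA leq_add2l leq_addl.
apply: does_seq (does_push _ _ _ _ _) _ => /=.
by have := Hq (exist _ i ne) m => /(does_le (HG _)) /=; rewrite /X /= El.
Qed.

(** The left part of the state is the guard, with [Leaf] ending the loop. A bound [B] on all
    intermediate states is required besides the bound [N] on the rounds, because iterating a
    polynomial-time body can make sizes grow exponentially. *)
Lemma polytime_while I (x : I -> tree) (s : I -> nat -> tree) (N B : I -> nat) :
  poly_bounded x N -> poly_bounded x B ->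
  (forall i j, j <= N i -> tsize (s i j) <= B i) ->
  (forall i, s i 0 = x i) ->
  (forall i j, j < N i -> exists a b c, s i j = Node (Node a b) c) ->
  (forall i, exists c, s i (N i) = Node Leaf c) ->
  polytime (fun ij : {ij : I * nat | ij.2 < N ij.1} => s (sval ij).1 (sval ij).2)
           (fun ij => s (sval ij).1 (sval ij).2.+1) ->
  polytime x (fun i => s i (N i)).
Proof.
move=> HN HB leB s0 sN sE Hbody k.
have [p [F [[c [d HF]] Hp]]] := Hbody (k + 1).
(* Register k holds a flag and register k + 1 the state. The code of the state begins with the bit
   of its root, so the second bit tells whether the guard is [Leaf]; the first bit is popped to see
   it and then pushed back. *)
pose L := Loop (k + 0) (Seq (Pop (k + 1)) (Case (k + 1) (Seq (Push (k + 1) true) p)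
  (Seq (Push (k + 1) true) (Pop (k + 0))) Skip)).
exists (Seq (move3 (k + 0) (k + 1) (k + 2)) (Seq (Push (k + 0) true)
         (Seq L (move3 (k + 1) (k + 0) (k + 2))))).
exists (fun i => (10 * tsize (x i) + 2) + (2 +
  ((N i).+1 * (c * B i ^ d + 8) + (10 * B i + 2)))); split.
  apply: (@poly_bounded_le _ _ _ (fun i => (10 * tsize (x i) + 2) + (2 +
     ((N i + 1) * (c * B i ^ d + 8) + (10 * B i + 2))))).
    by move=> i; rewrite addn1.
  by pbound.
move=> i m.
rewrite -size_code; apply: does_seq (@does_move3 m k [:: code (x i)] 0 1 2 _ _ _ _ _ _) _ => //.
apply: does_seq (does_push _ _ _ _ _) _ => /=.
apply: (@does_seq _ _ _ _ (layout m k [:: [::]; code (s i (N i))])); last first.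
  apply: (@does_le _ _ (10 * size (code (s i (N i))) + 2)).
    by rewrite size_code leq_add2r leq_mul2l leB.
  have := @does_move3 m k [:: [::]; code (s i (N i))] 1 0 2 isT isT isT isT erefl erefl.
  by rewrite /= (layout_rcons m k [:: code (s i (N i))]).
rewrite -s0.
suff main j : j <= N i ->
  does L (layout m k [:: [:: true]; code (s i (N i - j))]) (j.+1 * (c * B i ^ d + 8))
    (layout m k [:: [::]; code (s i (N i))]) by have := main (N i) (leqnn _); rewrite subnn.
elim: j => [_|j IH lt_j].
  rewrite subn0; have [e ->] := sE i; rewrite mul1n.
  apply: (@does_le _ _ (5 + 1).+1); first lia.
  apply: does_loop; [by rewrite layoutE| |by apply: does_loop_end; rewrite layoutE].
  apply: (@does_seq _ _ _ 1 _ 4); first exact: does_pop.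
  apply: does_case; rewrite layoutE /=.
  apply: (@does_seq _ _ _ 2 _ 1); first exact: does_push.
  exact: (does_pop m k [:: [:: true]; true :: false :: code e] 0).
have lt_N : N i - j.+1 < N i by lia.
have [a [b [e Es]]] := sN _ _ lt_N.
apply: (@does_le _ _ (1 + (2 + c * B i ^ d).+1 + j.+1 * (c * B i ^ d + 8)).+1).
  by rewrite [j.+2 * _]mulSn; lia.
apply: does_loop (IH (ltnW lt_j)); first by rewrite layoutE.
apply: does_seq (does_pop _ _ _ _) _; apply: does_case.
rewrite layoutE Es /=.
apply: does_seq (does_push _ _ _ _ _) _ => /=.
have := Hp (exist _ (i, N i - j.+1) lt_N) (layout m k [:: [:: true]]).
rewrite -!layout_shift /= Es (_ : (N i - j.+1).+1 = N i - j); last lia.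
apply: does_le; apply: leq_trans (HF _) _ => /=.
by rewrite leq_mul2l leq_wexp2r ?orbT // leB // ltnW.
Qed.

(** * Polynomial-time functions on encoded types *)

Definition tcar (x : tree) : tree := if x is Node y _ then y else Leaf.
Definition tcdr (x : tree) : tree := if x is Node _ z then z else Leaf.

Lemma polytime_tcar I (x y : I -> tree) :
  (forall i, y i <> Leaf) -> polytime x y -> polytime x (fun i => tcar (y i)).
Proof.
move=> ne H; apply: polytime_comp H _.
apply: polytime_reindex (polytime_car (fun i => tcar (y i)) (fun i => tcdr (y i))).
by move=> i; exists i; split=> //; case: (y i) (ne i).
Qed.

Lemma polytime_tcdr I (x y : I -> tree) :
  (forall i, y i <> Leaf) -> polytime x y -> polytime x (fun i => tcdr (y i)).
Proof.
move=> ne H; apply: polytime_comp H _.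
apply: polytime_reindex (polytime_cdr (fun i => tcar (y i)) (fun i => tcdr (y i))).
by move=> i; exists i; split=> //; case: (y i) (ne i).
Qed.

Structure encodable := Encodable { carrier :> Type; encode : carrier -> tree }.
Arguments encode {e} a.

Canonical unit_encodable := @Encodable unit (fun _ => Leaf).
Canonical bool_encodable :=
  @Encodable bool (fun b => if b then Node Leaf Leaf else Leaf).
(* Natural numbers are encoded in unary; see [bignat] for binary notation. *)
Canonical nat_encodable := @Encodable nat (fun n => iter n (Node Leaf) Leaf).
Canonical prod_encodable (A B : encodable) :=
  @Encodable (A * B) (fun p => Node (encode p.1) (encode p.2)).
Canonical seq_encodable (A : encodable) :=
  @Encodable (seq A) (foldr (fun a t => Node (encode a) t) Leaf).

Definition esize (A : encodable) (a : A) : nat := tsize (encode a).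

Definition FP (A B : encodable) (f : A -> B) : Prop :=
  polytime (fun a => encode a) (fun a => encode (f a)).

Definition esize_bounded (A : encodable) (F : A -> nat) : Prop :=
  poly_bounded (fun a => encode a) F.

Lemma esize_gt0 (A : encodable) (a : A) : 0 < esize a.
Proof. exact: tsize_gt0. Qed.

Lemma esize_pair (A B : encodable) (a : A) (b : B) :
  esize (a, b) = (esize a + esize b).+1.
Proof. by []. Qed.

Lemma esize_cons (A : encodable) (a : A) l :
  esize (a :: l) = (esize a + esize l).+1.
Proof. by []. Qed.

Lemma esize_cat (A : encodable) (s t : seq A) :
  (esize (s ++ t)).+1 = esize s + esize t.
Proof. by elim: s => // a s IH; rewrite cat_cons !esize_cons; lia. Qed.

Lemma esize_take (A : encodable) j (s : seq A) : esize (take j s) <= esize s.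
Proof.
have := esize_cat (take j s) (drop j s); rewrite cat_take_drop.
by have := esize_gt0 (drop j s); lia.
Qed.

Lemma esize_drop (A : encodable) j (s : seq A) : esize (drop j s) <= esize s.
Proof.
have := esize_cat (take j s) (drop j s); rewrite cat_take_drop.
by have := esize_gt0 (take j s); lia.
Qed.

Lemma esize_rev (A : encodable) (s : seq A) : esize (rev s) = esize s.
Proof.
elim: s => // a s IH; rewrite rev_cons -cats1.
by have := esize_cat (rev s) [:: a]; rewrite IH !esize_cons; 
  have : esize (Nil A) = 1 by []; lia.
Qed.

Lemma size_le_esize (A : encodable) (s : seq A) : size s < esize s.
Proof. by elim: s => // a s IH; rewrite esize_cons /=; lia. Qed.

Lemma esize_nat (n : nat) : esize n = (2 * n).+1.
Proof.
by elim: n => // n IH; rewrite /esize /= -/(esize n) in IH *; rewrite IH; lia.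
Qed.

Lemma esize_bool (b : bool) : esize b <= 3.
Proof. by case: b. Qed.

Lemma esize_bits (s : seq bool) : esize s <= 4 * size s + 1.
Proof. by elim: s => // b s IH; rewrite esize_cons /=; have := esize_bool b; lia. Qed.

Section Basic.
Context {A B C : encodable}.

Lemma FP_id : FP (fun a : A => a).
Proof. exact: polytime_id. Qed.

Lemma FP_comp (f : A -> B) (g : B -> C) : FP f -> FP g -> FP (fun a => g (f a)).
Proof.
move=> Hf Hg; apply: polytime_comp Hf _.
by apply: polytime_reindex Hg => a; exists (f a).
Qed.

Lemma FP_const (b : B) : FP (fun _ : A => b).
Proof. exact: polytime_const. Qed.

(** Types with equal encodings become interchangeable at no cost: unary numbers and lists of units,
    [bignat] and lists of bits. *)
Lemma FP_encode_eq (f : A -> B) (g : A -> C) :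
  (forall a, encode (f a) = encode (g a)) -> FP f -> FP g.
Proof. exact: polytime_ext. Qed.

Lemma FP_ext (f g : A -> B) : f =1 g -> FP f -> FP g.
Proof. by move=> E; apply: polytime_ext => a; rewrite E. Qed.

Lemma FP_pair (f : A -> B) (g : A -> C) : FP f -> FP g -> FP (fun a => (f a, g a)).
Proof. exact: polytime_node. Qed.

Lemma FP_fst (f : A -> B * C) : FP f -> FP (fun a => (f a).1).
Proof. by move=> Hf; apply: polytime_comp Hf (polytime_car _ _). Qed.

Lemma FP_snd (f : A -> B * C) : FP f -> FP (fun a => (f a).2).
Proof. by move=> Hf; apply: polytime_comp Hf (polytime_cdr _ _). Qed.

Lemma FP_cons (f : A -> B) (g : A -> seq B) :
  FP f -> FP g -> FP (fun a => f a :: g a).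
Proof. exact: polytime_node. Qed.

Lemma FP_if (c : A -> bool) (f g : A -> B) :
  FP c -> FP f -> FP g -> FP (fun a => if c a then f a else g a).
Proof.
move=> Hc Hf Hg; apply: polytime_case Hc _ _.
  apply: polytime_reindex Hg => -[a /= E]; exists a; split=> //.
  by case: (c a) E.
apply: polytime_comp (polytime_cdr _ _) _.
apply: polytime_reindex Hf => -[a /= E]; exists a; split=> //.
by case: (c a) E.
Qed.

Lemma FP_seq_case (l : A -> seq B) (f : A -> C) (g : A -> B -> seq B -> C) :
  FP l -> FP f -> FP (fun p : A * (B * seq B) => g p.1 p.2.1 p.2.2) ->
  FP (fun a => if l a is h :: t then g a h t else f a).
Proof.
move=> Hl Hf Hg; apply: polytime_case Hl _ _.
  apply: polytime_reindex Hf => -[a /= E]; exists a; split=> //.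
  by case: (l a) E.
apply: polytime_comp (polytime_node (polytime_cdr _ _) (polytime_car _ _)) _.
apply: polytime_reindex Hg => -[a /= E].
by case: (l a) E => // h t _; exists (a, (h, t)).
Qed.

Lemma FP_bounded (f : A -> B) F : FP f -> esize_bounded F ->
  esize_bounded (fun a => F (f a)).
Proof.
move=> Hf HF; apply: poly_bounded_comp (polytime_size Hf) _.
exact: (poly_bounded_reindex f HF).
Qed.

Lemma FP_esize (f : A -> B) : FP f -> esize_bounded (fun a => esize (f a)).
Proof. by move=> Hf; apply: (FP_bounded Hf); apply: poly_bounded_size. Qed.

End Basic.

Lemma FP_esize2 (A B C : encodable) (f : A -> B -> C) :
  FP (fun p : A * B => f p.1 p.2) ->
  exists c d, forall a b, esize (f a b) <= c * (esize a + esize b).+1 ^ d.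
Proof.
by move=> /FP_esize[c [d Hc]]; exists c, d => a b; apply: (Hc (a, b)).
Qed.


(** The one use of the general loop, to which all later iterations reduce. Its state holds the rest
    of the list, the argument and the accumulator; the rest of the list doubles as guard, since a
    nonempty list is encoded by a node. *)
Lemma FP_foldl (A B C : encodable)
    (l : A -> seq C) (i : A -> B) (g : A -> B -> C -> B) (b : A -> nat) :
  FP l -> FP i -> FP (fun p : A * B * C => g p.1.1 p.1.2 p.2) ->
  esize_bounded b ->
  (forall a j, esize (foldl (g a) (i a) (take j (l a))) <= b a) ->
  FP (fun a => foldl (g a) (i a) (l a)).
Proof.
move=> Hl Hi Hg Hb leb.
pose acc a j := foldl (g a) (i a) (take j (l a)).
pose s a j := Node (encode (drop j (l a))) (Node (encode a) (encode (acc a j))).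
pose N a := size (l a).
have H0 : polytime (fun a => encode a) (fun a => s a 0).
  apply: (@polytime_ext _ _
    (fun a => Node (encode (l a)) (Node (encode a) (encode (i a))))).
    by move=> a; rewrite /s /acc drop0 take0.
  by apply: polytime_node => //; apply: polytime_node => //; apply: polytime_id.
have Hs0 F : esize_bounded F -> poly_bounded (fun a => s a 0) F.
  apply: poly_bounded_comp; apply: (@poly_bounded_le _ _ _ (fun a => tsize (s a 0))).
    by move=> a /=; lia.
  exact: poly_bounded_size.
suff H1 : polytime (fun a => s a 0) (fun a => s a (N a)).
  have := polytime_comp (polytime_comp H0 H1)
    (polytime_comp (polytime_cdr _ _) (polytime_cdr _ _)).
  by apply: polytime_ext => a; rewrite /acc take_size.
apply: (polytime_while (B := fun a => 2 + esize (l a) + esize a + b a)) => //.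
- apply: Hs0; apply: (poly_bounded_le (G := fun a => esize (l a))).
    by move=> a; apply: ltnW; apply: size_le_esize.
  exact: FP_esize.
- have := FP_esize Hl => ?; apply: Hs0.
  by pbound; apply: poly_bounded_size.
- move=> a j _; have := esize_drop j (l a); have := leb a j.
  have -> : tsize (s a j) =
    (esize (drop j (l a)) + (esize a + esize (acc a j)).+1).+1 by [].
  by rewrite /acc; lia.
- move=> a j lt_j; rewrite /s.
  case E: (drop j (l a)) => [|h t]; last by exists (encode h), (encode t); eexists.
  by move: (size_drop j (l a)); rewrite E /=; rewrite /N in lt_j; lia.
- by move=> a; rewrite /s /N drop_size; eexists.
pose J := {ij : A * nat | ij.2 < N ij.1}.
pose a_ (q : J) := (sval q).1; pose j_ (q : J) := (sval q).2.
pose sq q := s (a_ q) (j_ q).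
have neq q : encode (drop (j_ q) (l (a_ q))) <> Leaf.
  case: q => -[a j] /= lt_j; rewrite /a_ /j_ /=.
  case E: (drop j (l a)) => [|h t] //.
  by move: (size_drop j (l a)); rewrite E /=; rewrite /N in lt_j; lia.
have Hd : polytime sq (fun q => encode (drop (j_ q) (l (a_ q)))) by exact: polytime_car.
have Hxa : polytime sq (fun q => Node (encode (a_ q)) (encode (acc (a_ q) (j_ q)))).
  exact: polytime_cdr.
have He := polytime_tcar neq Hd; have Ht := polytime_tcdr neq Hd.
have Hx := polytime_comp Hxa (polytime_car _ _).
apply: (@polytime_ext _ _ (fun q => Node (tcdr (encode (drop (j_ q) (l (a_ q)))))
   (Node (encode (a_ q)) (encode (acc (a_ q) (j_ q).+1))))).
  case=> -[a j] /= lt_j; rewrite /s /a_ /j_ /= -(addn1 j) addnC -drop_drop.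
  by rewrite drop1; case: (drop j (l a)).
apply: polytime_node => //; apply: polytime_node => //.
apply: polytime_comp (polytime_node Hxa He) _.
apply: polytime_reindex Hg => -[[a j] /= lt_j]; rewrite /a_ /j_ /acc /=.
have := cat_take_drop j (l a); have := size_drop j (l a).
case E: (drop j (l a)) => [|h t] /= E1 E2; first by rewrite /N in lt_j; lia.
exists ((a, acc a j), h); split=> //=.
have -> : take j.+1 (l a) = rcons (take j (l a)) h.
  rewrite -{1}E2 -cat_rcons take_size_cat // size_rcons size_takel //.
  by rewrite ltnW.
by rewrite foldl_rcons.
Qed.

(** * Lists and unary numbers *)

Lemma FP_negb (A : encodable) (b : A -> bool) : FP b -> FP (fun a => ~~ b a).
Proof. by move=> Hb; apply: (FP_if Hb (FP_const false) (FP_const true)). Qed.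

Lemma FP_andb (A : encodable) (b c : A -> bool) : FP b -> FP c -> FP (fun a => b a && c a).
Proof. by move=> Hb Hc; apply: (FP_if Hb Hc (FP_const false)). Qed.

Lemma FP_eqb (A : encodable) (b c : A -> bool) : FP b -> FP c -> FP (fun a => b a == c a).
Proof.
move=> Hb Hc; apply: (FP_ext _ (FP_if Hb Hc (FP_negb Hc))) => a.
by case: (b a) (c a) => -[].
Qed.

Lemma FP_behead (A B : encodable) (l : A -> seq B) : FP l -> FP (fun a => behead (l a)).
Proof.
move=> Hl; apply: (FP_ext (f := fun a => if l a is h :: t then t else [::])).
  by move=> a; case: (l a).
exact: (FP_seq_case Hl (FP_const [::]) (FP_snd (FP_snd FP_id))).
Qed.

Lemma FP_head (A B : encodable) (x : B) (l : A -> seq B) : FP l -> FP (fun a => head x (l a)).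
Proof.
move=> Hl; apply: (FP_ext (f := fun a => if l a is h :: t then h else x)).
  by move=> a; case: (l a).
exact: (FP_seq_case Hl (FP_const x) (FP_fst (FP_snd FP_id))).
Qed.

Lemma FP_nilp (A B : encodable) (l : A -> seq B) : FP l -> FP (fun a => nilp (l a)).
Proof.
move=> Hl; apply: (FP_ext (f := fun a => if l a is h :: t then false else true)).
  by move=> a; case: (l a).
exact: (FP_seq_case Hl (FP_const true) (FP_const false)).
Qed.

Lemma FP_rev (A B : encodable) (l : A -> seq B) : FP l -> FP (fun a => rev (l a)).
Proof.
move=> Hl; have E (s : seq B) : foldl (fun z x => x :: z) [::] s = rev s.
  by elim/last_ind: s => // s x IH; rewrite foldl_rcons IH rev_rcons.
apply: (FP_ext (f := fun a => foldl (fun z x => x :: z) [::] (l a))) => //.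
apply: (FP_foldl (g := fun _ z x => x :: z) (b := fun a => esize (l a))) => //.
- exact: FP_const.
- exact: (FP_cons (FP_snd FP_id) (FP_snd (FP_fst FP_id))).
- exact: FP_esize.
- by move=> a j; rewrite E esize_rev esize_take.
Qed.

Lemma esize_map_le (A B C : encodable) (a : A) (f : A -> B -> C) c d M (s : seq B) :
  (forall a b, esize (f a b) <= c * (esize a + esize b).+1 ^ d) ->
  esize s <= M ->
  esize (map (f a) s) <= (size s * (c * (esize a + M).+1 ^ d + 1)).+1.
Proof.
move=> Hf; elim: s => // b s IH; rewrite /= !esize_cons => le_M.
have /IH le1 : esize s <= M by lia.
have le2 : esize (f a b) <= c * (esize a + M).+1 ^ d.
  by apply: leq_trans (Hf a b) _; rewrite leq_mul2l leq_wexp2r ?orbT //; lia.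
by rewrite mulSn; lia.
Qed.

Lemma FP_map (A B C : encodable) (l : A -> seq B) (f : A -> B -> C) :
  FP l -> FP (fun p : A * B => f p.1 p.2) -> FP (fun a => map (f a) (l a)).
Proof.
move=> Hl Hf; have [c [d le_f]] := FP_esize2 Hf.
have E a s : foldl (fun z x => f a x :: z) [::] s = rev (map (f a) s).
  by elim/last_ind: s => // s x IH; rewrite foldl_rcons IH map_rcons rev_rcons.
apply: (FP_ext (f := fun a => rev (foldl (fun z x => f a x :: z) [::] (l a)))).
  by move=> a; rewrite E revK.
apply: FP_rev; apply: (FP_foldl (g := fun a z x => f a x :: z)
  (b := fun a => esize (l a) * (c * (esize a + esize (l a) + 1) ^ d + 1) + 1)) => //.
- exact: FP_const.
- apply: FP_cons; last exact: (FP_snd (FP_fst FP_id)).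
  exact: (FP_comp (FP_pair (FP_fst (FP_fst FP_id)) (FP_snd FP_id)) Hf).
- by have := FP_esize Hl => ?; pbound; apply: poly_bounded_size.
- move=> a j; rewrite E esize_rev.
  apply: leq_trans (esize_map_le _ le_f (esize_take j (l a))) _.
  rewrite !addn1 ltnS leq_mul2r; apply/orP; right.
  by apply: leq_trans (ltnW (size_le_esize _)); rewrite size_take_min geq_minr.
Qed.

Lemma encode_nat n : encode n = encode (nseq n tt).
Proof. by elim: n => //= n ->. Qed.

Lemma FP_nseq_tt (A : encodable) (n : A -> nat) : FP n -> FP (fun a => nseq (n a) tt).
Proof. by apply: FP_encode_eq => a; rewrite encode_nat. Qed.

Lemma FP_iter (A B : encodable) (n : A -> nat) (i : A -> B) (g : A -> B -> B) (b : A -> nat) :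
  FP n -> FP i -> FP (fun p : A * B => g p.1 p.2) -> esize_bounded b ->
  (forall a j, j <= n a -> esize (iter j (g a) (i a)) <= b a) ->
  FP (fun a => iter (n a) (g a) (i a)).
Proof.
move=> Hn Hi Hg Hb leb.
have E a j x : foldl (fun x (_ : unit) => g a x) x (nseq j tt) = iter j (g a) x.
  by elim: j x => // j IH x; rewrite /= IH -iterSr.
apply: (FP_ext (f := fun a => foldl (fun x (_ : unit) => g a x) (i a) (nseq (n a) tt))).
  by move=> a; rewrite E.
apply: (FP_foldl (g := fun a x (_ : unit) => g a x) (b := b)) => //.
- exact: FP_nseq_tt.
- exact: (FP_comp (FP_fst FP_id) Hg).
- move=> a j; have [le_j|/ltnW le_n] := leqP j (n a).
    by rewrite take_nseq // E leb.
  by rewrite take_oversize ?size_nseq // E leb.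
Qed.

Lemma FP_size (A B : encodable) (l : A -> seq B) : FP l -> FP (fun a => size (l a)).
Proof.
move=> Hl; apply: (FP_encode_eq (f := fun a => map (fun _ => tt) (l a))).
  by move=> a; rewrite encode_nat; congr encode; elim: (l a) => //= ? ? ->.
exact: (FP_map (f := fun _ _ => tt) Hl (FP_const tt)).
Qed.

Lemma FP_drop (A B : encodable) (n : A -> nat) (l : A -> seq B) :
  FP n -> FP l -> FP (fun a => drop (n a) (l a)).
Proof.
move=> Hn Hl; have E (s : seq B) j : iter j behead s = drop j s.
  by elim: j => [|j IH]; rewrite ?drop0 // iterS IH -drop1 drop_drop.
apply: (FP_ext (f := fun a => iter (n a) behead (l a))) => [a|]; first by rewrite E.
apply: (FP_iter (g := fun _ => behead) (b := fun a => esize (l a))) => //.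
- exact: (FP_behead (FP_snd FP_id)).
- exact: FP_esize.
- by move=> a j _; rewrite E esize_drop.
Qed.

Lemma FP_nth (A B : encodable) (x : B) (l : A -> seq B) (n : A -> nat) :
  FP l -> FP n -> FP (fun a => nth x (l a) (n a)).
Proof.
move=> Hl Hn; apply: (FP_ext _ (FP_head x (FP_drop Hn Hl))) => a.
by rewrite -nth0 nth_drop addn0.
Qed.

Lemma FP_cat (A B : encodable) (s t : A -> seq B) : FP s -> FP t -> FP (fun a => s a ++ t a).
Proof.
move=> Hs Ht; have E (u v : seq B) : foldl (fun z x => x :: z) v u = rev u ++ v.
  by elim: u v => // x u IH v; rewrite /= IH rev_cons cat_rcons.
apply: (FP_ext (f := fun a => foldl (fun z x => x :: z) (t a) (rev (s a)))).
  by move=> a; rewrite E revK.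
apply: (FP_foldl (g := fun _ z x => x :: z) (b := fun a => esize (s a) + esize (t a))) => //.
- exact: FP_rev.
- exact: (FP_cons (FP_snd FP_id) (FP_snd (FP_fst FP_id))).
- by have := FP_esize Hs; have := FP_esize Ht => *; pbound.
- move=> a j; rewrite E.
  have := esize_cat (rev (take j (rev (s a)))) (t a).
  by have := esize_take j (rev (s a)); rewrite !esize_rev; lia.
Qed.

Lemma FP_bounded_nat (A : encodable) (n : A -> nat) : FP n -> esize_bounded n.
Proof.
move=> Hn; apply: poly_bounded_le (FP_esize Hn) => a.
by rewrite esize_nat; lia.
Qed.

Lemma FP_succ (A : encodable) (n : A -> nat) : FP n -> FP (fun a => (n a).+1).
Proof. by move=> Hn; apply: polytime_node => //; apply: polytime_const. Qed.

Lemma FP_addn (A : encodable) (m n : A -> nat) : FP m -> FP n -> FP (fun a => m a + n a).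
Proof.
move=> Hm Hn.
apply: (FP_ext _ (FP_size (FP_cat (FP_nseq_tt Hm) (FP_nseq_tt Hn)))) => a.
by rewrite size_cat !size_nseq.
Qed.

Lemma FP_subn (A : encodable) (m n : A -> nat) : FP m -> FP n -> FP (fun a => m a - n a).
Proof.
move=> Hm Hn.
apply: (FP_ext _ (FP_size (FP_drop Hn (FP_nseq_tt Hm)))) => a.
by rewrite size_drop size_nseq.
Qed.

Lemma FP_muln (A : encodable) (m n : A -> nat) : FP m -> FP n -> FP (fun a => m a * n a).
Proof.
move=> Hm Hn; apply: (FP_ext (f := fun a => iter (m a) (addn (n a)) 0)) => [a|].
  by rewrite iter_addn_0 mulnC.
apply: (FP_iter (g := fun a => addn (n a)) (b := fun a => 2 * (n a * m a) + 1)) => //.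
- exact: FP_const.
- exact: (FP_addn (FP_comp (FP_fst FP_id) Hn) (FP_snd FP_id)).
- by have := FP_bounded_nat Hm; have := FP_bounded_nat Hn => *; pbound.
- by move=> a j le_j; rewrite iter_addn_0 esize_nat addn1 ltnS !leq_mul2l le_j !orbT.
Qed.

Lemma FP_leq (A : encodable) (m n : A -> nat) : FP m -> FP n -> FP (fun a => m a <= n a).
Proof.
move=> Hm Hn.
apply: (FP_ext _ (FP_nilp (FP_nseq_tt (FP_subn Hm Hn)))) => a.
by rewrite /nilp size_nseq.
Qed.

Lemma FP_eqn (A : encodable) (m n : A -> nat) : FP m -> FP n -> FP (fun a => m a == n a).
Proof.
move=> Hm Hn; apply: (FP_ext _ (FP_andb (FP_leq Hm Hn) (FP_leq Hn Hm))) => a.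
by rewrite eqn_leq.
Qed.

Lemma FP_take (A B : encodable) (n : A -> nat) (l : A -> seq B) :
  FP n -> FP l -> FP (fun a => take (n a) (l a)).
Proof.
move=> Hn Hl.
apply: (FP_ext _ (FP_rev (FP_drop (FP_subn (FP_size Hl) Hn) (FP_rev Hl)))) => a.
rewrite drop_rev revK; have [le_n|/ltnW le_n] := leqP (n a) (size (l a)).
  by rewrite subKn.
have -> : size (l a) - n a = 0 by lia.
by rewrite subn0 take_size take_oversize.
Qed.

Lemma FP_nseq (A B : encodable) (n : A -> nat) (x : A -> B) :
  FP n -> FP x -> FP (fun a => nseq (n a) (x a)).
Proof.
move=> Hn Hx.
apply: (FP_ext (f := fun a => map (fun _ => x a) (nseq (n a) tt))).
  by move=> a; rewrite map_nseq.
apply: (FP_map (f := fun a (_ : unit) => x a)) (FP_nseq_tt Hn) _.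
exact: (FP_comp (FP_fst FP_id) Hx).
Qed.

Lemma FP_iota (A : encodable) (n : A -> nat) : FP n -> FP (fun a => iota 0 (n a)).
Proof.
move=> Hn; pose g (l : seq nat) := size l :: l.
have E j : iter j g [::] = rev (iota 0 j).
  elim: j => // j IH; rewrite iterS IH -[in RHS]addn1 iotaD rev_cat.
  by rewrite /g size_rev size_iota.
have le_iota k j : esize (iota k j) <= j * (2 * (k + j) + 2) + 1.
  elim: j k => // j IH k; rewrite /= esize_cons esize_nat.
  by have := IH k.+1; rewrite mulSn addSnnS; lia.
apply: (FP_ext (f := fun a => rev (iter (n a) g [::]))) => [a|].
  by rewrite E revK.
apply: FP_rev; apply: (FP_iter (g := fun _ => g)
    (b := fun a => n a * (2 * n a + 2) + 1)) => //.
- exact: FP_const.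
- exact: (FP_cons (FP_size (FP_snd FP_id)) (FP_snd FP_id)).
- by have := FP_bounded_nat Hn => *; pbound.
- move=> a j le_j; rewrite E esize_rev; apply: leq_trans (le_iota _ _) _.
  by rewrite add0n leq_add2r leq_mul // leq_add2r leq_mul2l.
Qed.

Lemma FP_count (A B : encodable) (l : A -> seq B) (p : A -> B -> bool) :
  FP l -> FP (fun q : A * B => p q.1 q.2) -> FP (fun a => count (p a) (l a)).
Proof.
move=> Hl Hp; pose g a n x := if p a x then n.+1 else n.
have E a s : foldl (g a) 0 s = count (p a) s.
  elim/last_ind: s => // s x IH; rewrite foldl_rcons IH -cats1 count_cat /= addn0 /g.
  by case: (p a x); lia.
apply: (FP_ext (f := fun a => foldl (g a) 0 (l a))) => [a|]; first by rewrite E.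
apply: (FP_foldl (b := fun a => 2 * esize (l a) + 1)) => //.
- exact: FP_const.
- have Hn : FP (fun p : A * nat * B => p.1.2) by exact: (FP_snd (FP_fst FP_id)).
  apply: FP_if (FP_succ Hn) Hn.
  exact: (FP_comp (FP_pair (FP_fst (FP_fst FP_id)) (FP_snd FP_id)) Hp).
- by have := FP_esize Hl => *; pbound.
- move=> a j; rewrite E esize_nat addn1 ltnS leq_mul2l /=.
  apply: leq_trans (count_size _ _) _; apply: leq_trans (ltnW (size_le_esize _)).
  by rewrite size_take_min geq_minr.
Qed.

Lemma FP_all (A B : encodable) (l : A -> seq B) (p : A -> B -> bool) :
  FP l -> FP (fun q : A * B => p q.1 q.2) -> FP (fun a => all (p a) (l a)).
Proof.
move=> Hl Hp; apply: (FP_ext _ (FP_eqn (FP_count Hl Hp) (FP_size Hl))) => a.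
by rewrite all_count.
Qed.

Lemma FP_has (A B : encodable) (l : A -> seq B) (p : A -> B -> bool) :
  FP l -> FP (fun q : A * B => p q.1 q.2) -> FP (fun a => has (p a) (l a)).
Proof.
move=> Hl Hp; apply: (FP_ext _ (FP_leq (FP_const 1) (FP_count Hl Hp))) => a.
by rewrite has_count.
Qed.

(** * Numbers in binary notation *)

(** A wrapper, so that [nat] keeps its unary encoding. Indices, lengths and exponents are unary,
    values of generating functions are binary. *)
Record bignat := Bignat { bigval : nat }.

Canonical bignat_encodable :=
  @Encodable bignat (fun b => encode (binary (bigval b))).

Fixpoint bitval (s : seq bool) : nat :=
  if s is b :: s' then b + 2 * bitval s' else 0.

Lemma size_binary n : size (binary n) = up_log 2 n.+1.
Proof. by rewrite size_mkseq. Qed.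

Lemma ltn_binary n : n < 2 ^ size (binary n).
Proof. by rewrite size_binary; apply: up_logP. Qed.

Lemma size_binary_le n k : n < 2 ^ k -> size (binary n) <= k.
Proof. by rewrite size_binary => H; rewrite up_log_min. Qed.

Lemma nth_binary n k : nth false (binary n) k = odd (n %/ 2 ^ k).
Proof.
have [lt_k|le_k] := ltnP k (size (binary n)).
  by rewrite nth_mkseq // -size_binary.
rewrite nth_default // divn_small //.
by apply: leq_trans (ltn_binary n) _; rewrite leq_exp2l.
Qed.

(** The hypothesis excludes the number 0, whose notation is empty rather than a single zero. *)
Lemma binary_double b n : b || (0 < n) -> binary (b + 2 * n) = b :: binary n.
Proof.
move=> pos; have Eh : (b + 2 * n)./2 = n by rewrite mul2n half_bit_double.
have Es : up_log 2 (b + 2 * n).+1 = (up_log 2 n.+1).+1.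
  have [n0 | n0] := posnP n.
    by move: pos; rewrite n0 {Eh}; case: b.
  rewrite !up_log_trunc_log // ?ltnS //; last by lia.
  by rewrite trunc_log2S ?Eh //; lia.
rewrite /binary Es /mkseq -[iota 0 _.+1]/(0 :: iota (1 + 0) _) iotaDl /=.
rewrite -map_comp; congr (_ :: _).
  by rewrite expn0 divn1 oddD mul2n odd_double addbF; case: b {pos Eh Es}.
apply: eq_map => k /=.
by rewrite add1n expnS divnMA divn2 Eh.
Qed.

Lemma bitval_binary n : bitval (binary n) = n.
Proof.
elim/ltn_ind: n => n IH; have [-> //|n0] := posnP n.
rewrite -{1}(odd_double_half n) -mul2n binary_double; last first.
  by case: odd (odd_double_half n) => //= E; lia.
rewrite /= IH; first by rewrite mul2n odd_double_half.
by rewrite ltn_half_double; lia.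
Qed.

Definition trim (s : seq bool) : seq bool :=
  foldr (fun b t => if nilp t then (if b then [:: b] else [::]) else b :: t)
    [::] s.

Lemma trimE s : trim s = binary (bitval s).
Proof.
elim: s => //= b s ->.
have [-> | s0] := posnP (bitval s); first by case: b.
have -> : nilp (binary (bitval s)) = false.
  by apply/negP => /nilP E; move: (bitval_binary (bitval s)) s0; rewrite E /= => <-.
by rewrite binary_double // s0 orbT.
Qed.

Lemma esize_trim s : esize (trim s) <= esize s.
Proof.
elim: s => // b s IH; rewrite [trim _]/= -/(trim s) esize_cons.
have : esize (Nil bool) = 1 by [].
by case: nilp; first case: b; rewrite ?esize_cons; have := esize_gt0 s; lia.
Qed.

Lemma bitval_cat s t : bitval (s ++ t) = bitval s + 2 ^ size s * bitval t.
Proof.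
elim: s => [|b s IH] /=; first by rewrite expn0; lia.
by rewrite IH expnS; lia.
Qed.

Lemma bitval_ub s : bitval s < 2 ^ size s.
Proof. by elim: s => // b s IH; rewrite /= expnS; case: b; lia. Qed.

Lemma bitval_nseq k : bitval (nseq k false) = 0.
Proof. by elim: k => //= k ->. Qed.

Lemma bitval_drop k s : bitval (drop k s) = bitval s %/ 2 ^ k.
Proof.
have [le_k|/ltnW le_s] := leqP k (size s); last first.
  rewrite drop_oversize // divn_small //; apply: leq_trans (bitval_ub s) _.
  by rewrite leq_exp2l.
rewrite -{2}(cat_take_drop k s) bitval_cat size_takel // addnC mulnC divnMDl ?expn_gt0 //.
rewrite divn_small ?addn0 //.
by have := bitval_ub (take k s); rewrite size_takel.
Qed.

Lemma bitval_take k s : bitval (take k s) = bitval s %% 2 ^ k.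
Proof.
have [le_k|/ltnW le_s] := leqP k (size s); last first.
  rewrite take_oversize // modn_small //; apply: leq_trans (bitval_ub s) _.
  by rewrite leq_exp2l.
rewrite -{2}(cat_take_drop k s) bitval_cat size_takel // addnC mulnC modnMDl.
by rewrite modn_small //; have := bitval_ub (take k s); rewrite size_takel.
Qed.

Lemma esize_bignat n k : n < 2 ^ k -> esize (Bignat n) <= 4 * k + 1.
Proof.
move=> /size_binary_le le_k; apply: leq_trans (esize_bits _) _ => /=.
by rewrite leq_add2r leq_mul2l le_k orbT.
Qed.

Lemma ltn_esize_bignat n : n < 2 ^ esize (Bignat n).
Proof.
apply: leq_trans (ltn_binary n) _; rewrite leq_exp2l //.
exact: ltnW (size_le_esize _).
Qed.

Lemma modn_expS n k : n %% 2 ^ k.+1 = n %% 2 ^ k + 2 ^ k * odd (n %/ 2 ^ k).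
Proof.
have p0 : 0 < 2 ^ k by rewrite expn_gt0.
rewrite {1}(divn_eq n (2 ^ k)) -{1}(odd_double_half (n %/ 2 ^ k)).
set b := odd _; set q := half _; set r := n %% 2 ^ k.
have lt_r : r < 2 ^ k by rewrite ltn_mod.
have -> : (b + q.*2) * 2 ^ k + r = q * 2 ^ k.+1 + (r + 2 ^ k * b).
  by rewrite expnS -mul2n; lia.
by rewrite modnMDl modn_small // expnS; case: b; lia.
Qed.

Lemma FP_bits (A : encodable) (f : A -> nat) :
  FP (fun a => Bignat (f a)) -> FP (fun a => binary (f a)).
Proof. exact: FP_encode_eq. Qed.

Lemma FP_bignat_bits (A : encodable) (s : A -> seq bool) :
  FP s -> FP (fun a => Bignat (bitval (s a))).
Proof.
move=> Hs; apply: (FP_encode_eq (f := fun a => trim (s a))) => [a|].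
  by rewrite trimE.
pose g (t : seq bool) b :=
  if nilp t then (if b then [:: b] else [::]) else b :: t.
have E (t : seq bool) : foldl g [::] (rev t) = trim t by rewrite foldl_rev.
apply: (FP_ext (f := fun a => foldl g [::] (rev (s a)))) => [a|]; first by rewrite E.
apply: (FP_foldl (g := fun _ => g) (b := fun a => esize (s a))).
- exact: FP_rev.
- exact: FP_const.
- have Ht : FP (fun p : A * seq bool * bool => p.1.2) by exact: (FP_snd (FP_fst FP_id)).
  have Hb : FP (fun p : A * seq bool * bool => p.2) by exact: (FP_snd FP_id).
  apply: FP_if (FP_nilp Ht) _ (FP_cons Hb Ht).
  exact: (FP_if Hb (FP_cons Hb (FP_const [::])) (FP_const [::])).
- exact: FP_esize.
- move=> a j; rewrite -(revK (take _ _)) E; apply: leq_trans (esize_trim _) _.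
  by rewrite esize_rev -(esize_rev (s a)) esize_take.
Qed.

(** Addition with carry from the least significant bit on. The loop invariant is the equation modulo
    2^j, with the carry as bit j. *)
Lemma FP_bignat_add (A : encodable) (f g : A -> nat) :
  FP (fun a => Bignat (f a)) -> FP (fun a => Bignat (g a)) ->
  FP (fun a => Bignat (f a + g a)).
Proof.
move=> /FP_bits Hf /FP_bits Hg.
pose x a k := nth false (binary (f a)) k; pose y a k := nth false (binary (g a)) k.
pose step a (p : bool * seq bool) k :=
  let x := x a k in let y := y a k in let c := p.1 in
  (if x then (if y then true else c) else (if y then c else false),
   ((x == y) == c) :: p.2).
(* One position beyond the sum of the lengths: both numbers are below 2^(K - 1), so no carry leaves
   the last position. *)
pose K a := (size (binary (f a)) + size (binary (g a))).+1.
have Hsize a j : size (foldl (step a) (false, [::]) (iota 0 j)).2 = j.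
  by elim: j => // j IH; rewrite -addn1 iotaD foldl_cat /= IH addn1.
have Hinv a j : let p := foldl (step a) (false, [::]) (iota 0 j) in
    bitval (rev p.2) + 2 ^ j * p.1 = f a %% 2 ^ j + g a %% 2 ^ j.
  elim: j => [|j IH]; first by rewrite /= !modn1.
  have := Hsize a j; rewrite -(addn1 j) iotaD foldl_cat !addn1 !modn_expS /=.
  move: IH => /=; case: (foldl _ _ _) => c s /= IH Es.
  rewrite /x /y !nth_binary rev_cons -cats1 bitval_cat size_rev Es /= expnS.
  by case: (odd (f a %/ _)) (odd (g a %/ _)) c IH => -[] [] /=; lia.
apply: (FP_ext (f := fun a => Bignat (bitval (rev (foldl (step a) (false, [::]) (iota 0 (K a))).2)))).
  move=> a; congr Bignat; have := Hinv a (K a) => /=.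
  case: (foldl _ _ _) => c s /=.
  have lef : f a < 2 ^ (K a).-1.
    by apply: leq_trans (ltn_binary _) _; rewrite leq_exp2l // leq_addr.
  have leg : g a < 2 ^ (K a).-1.
    by apply: leq_trans (ltn_binary _) _; rewrite leq_exp2l // leq_addl.
  have -> : 2 ^ K a = 2 * 2 ^ (K a).-1 by rewrite -expnS.
  by rewrite !modn_small; lia.
apply: FP_bignat_bits; apply: FP_rev; apply: FP_snd.
have HK : FP K by exact: (FP_succ (FP_addn (FP_size Hf) (FP_size Hg))).
apply: (FP_foldl (g := step) (b := fun a => 4 * K a + 5)).
- exact: FP_iota.
- exact: FP_const.
- pose D := prod_encodable (prod_encodable A (prod_encodable bool_encodable
    (seq_encodable bool_encodable))) nat_encodable.
  have Hx : FP (fun q : D => x q.1.1 q.2).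
    exact: (FP_nth _ (FP_comp (FP_fst (FP_fst FP_id)) Hf) (FP_snd FP_id)).
  have Hy : FP (fun q : D => y q.1.1 q.2).
    exact: (FP_nth _ (FP_comp (FP_fst (FP_fst FP_id)) Hg) (FP_snd FP_id)).
  have Hc : FP (fun q : D => q.1.2.1) by exact: (FP_fst (FP_snd (FP_fst FP_id))).
  have Hs : FP (fun q : D => q.1.2.2) by exact: (FP_snd (FP_snd (FP_fst FP_id))).
  apply: FP_pair.
    exact: (FP_if Hx (FP_if Hy (FP_const true) Hc) (FP_if Hy Hc (FP_const false))).
  exact: (FP_cons (FP_eqb (FP_eqb Hx Hy) Hc) Hs).
- by have := FP_bounded_nat HK => ?; pbound.
- move=> a j; have [le_j|/ltnW le_K] := leqP j (K a).
    rewrite take_iota (minn_idPl le_j); have := Hsize a j.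
    case: (foldl _ _ _) => c s /= Es; rewrite esize_pair.
    by have := esize_bits s; have := esize_bool c; lia.
  rewrite take_oversize ?size_iota //; have := Hsize a (K a).
  case: (foldl _ _ _) => c s /= Es; rewrite esize_pair.
  by have := esize_bits s; have := esize_bool c; lia.
Qed.

(** Scanning from the least significant bit, the last position where the numbers differ decides, and
    there the bit of [g a] is the answer. *)
Lemma FP_bignat_leq (A : encodable) (f g : A -> nat) :
  FP (fun a => Bignat (f a)) -> FP (fun a => Bignat (g a)) ->
  FP (fun a => f a <= g a).
Proof.
move=> /FP_bits Hf /FP_bits Hg.
pose x a k := nth false (binary (f a)) k; pose y a k := nth false (binary (g a)) k.
pose step a r k := if x a k == y a k then r else y a k.
pose K a := size (binary (f a)) + size (binary (g a)).
have Hinv a j : foldl (step a) true (iota 0 j) = (f a %% 2 ^ j <= g a %% 2 ^ j).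
  elim: j => [|j IH]; first by rewrite !modn1.
  rewrite -addn1 iotaD foldl_cat addn1 /= IH /step /x /y !nth_binary !modn_expS.
  have : f a %% 2 ^ j < 2 ^ j by rewrite ltn_mod expn_gt0.
  have : g a %% 2 ^ j < 2 ^ j by rewrite ltn_mod expn_gt0.
  by case: (odd (f a %/ _)) (odd (g a %/ _)) => -[] /=; lia.
apply: (FP_ext (f := fun a => foldl (step a) true (iota 0 (K a)))).
  move=> a; rewrite Hinv !modn_small //.
    by apply: leq_trans (ltn_binary _) _; rewrite leq_exp2l // leq_addl.
  by apply: leq_trans (ltn_binary _) _; rewrite leq_exp2l // leq_addr.
apply: (FP_foldl (g := step) (b := fun a => 3)).
- exact: (FP_iota (FP_addn (FP_size Hf) (FP_size Hg))).
- exact: FP_const.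
- have Hx : FP (fun q : A * bool * nat => x q.1.1 q.2).
    exact: (FP_nth _ (FP_comp (FP_fst (FP_fst FP_id)) Hf) (FP_snd FP_id)).
  have Hy : FP (fun q : A * bool * nat => y q.1.1 q.2).
    exact: (FP_nth _ (FP_comp (FP_fst (FP_fst FP_id)) Hg) (FP_snd FP_id)).
  exact: (FP_if (FP_eqb Hx Hy) (FP_snd (FP_fst FP_id)) Hy).
- exact: poly_bounded_const.
- by move=> a j; apply: esize_bool.
Qed.

Section Powers.
Context (A : encodable) (f k : A -> nat).
Hypotheses (Hf : FP (fun a => Bignat (f a))) (Hk : FP k).

Lemma FP_bignat_mul_exp2 : FP (fun a => Bignat (f a * 2 ^ k a)).
Proof.
apply: (FP_ext _ (FP_bignat_bits (FP_cat (FP_nseq Hk (FP_const false)) (FP_bits Hf)))).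
by move=> a; rewrite bitval_cat bitval_nseq size_nseq bitval_binary mulnC.
Qed.

Lemma FP_bignat_div_exp2 : FP (fun a => Bignat (f a %/ 2 ^ k a)).
Proof.
apply: (FP_ext _ (FP_bignat_bits (FP_drop Hk (FP_bits Hf)))) => a.
by rewrite bitval_drop bitval_binary.
Qed.

Lemma FP_bignat_mod_exp2 : FP (fun a => Bignat (f a %% 2 ^ k a)).
Proof.
apply: (FP_ext _ (FP_bignat_bits (FP_take Hk (FP_bits Hf)))) => a.
by rewrite bitval_take bitval_binary.
Qed.

End Powers.

Lemma FP_bignat_sum (A B : encodable) (l : A -> seq B) (f : A -> B -> nat) :
  FP l -> FP (fun p : A * B => Bignat (f p.1 p.2)) ->
  FP (fun a => Bignat (\sum_(x <- l a) f a x)).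
Proof.
move=> Hl Hf; have [c [d le_f]] := FP_esize2 (f := fun a b => Bignat (f a b)) Hf.
pose g a z x := Bignat (bigval z + f a x).
have E a s : foldl (g a) (Bignat 0) s = Bignat (\sum_(x <- s) f a x).
  elim/last_ind: s => [|s x IH]; first by rewrite big_nil.
  by rewrite foldl_rcons IH -cats1 big_cat big_seq1.
apply: (FP_ext (f := fun a => foldl (g a) (Bignat 0) (l a))) => [a|]; first by rewrite E.
pose Q a := c * (esize a + esize (l a) + 1) ^ d.
apply: (FP_foldl (g := g) (b := fun a => 4 * (Q a + esize (l a)) + 1)) => //.
- exact: FP_const.
- apply: FP_bignat_add; first exact: (FP_snd (FP_fst FP_id)).
  exact: (FP_comp (FP_pair (FP_fst (FP_fst FP_id)) (FP_snd FP_id)) Hf).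
- by have := FP_esize Hl => ?; rewrite /Q; pbound; apply: poly_bounded_size.
- move=> a j; rewrite E; apply: esize_bignat.
  have : esize (take j (l a)) <= esize (l a) by exact: esize_take.
  have : size (take j (l a)) < esize (l a).
    by apply: leq_trans (size_le_esize _) (esize_take _ _).
  move: (take j (l a)) => s lt_s le_s.
  (* At most [Q a] bits for one summand, and one more bit for each addition. *)
  apply: (@leq_trans (2 ^ (Q a + size s) * 1)).
    rewrite muln1 {lt_s}; elim: s le_s => [|x s IH]; first by rewrite big_nil expn_gt0.
    rewrite esize_cons big_cons /= addnS expnS => le_s.
    have /IH : esize s <= esize (l a) by lia.
    have : f a x < 2 ^ Q a.
      apply: leq_trans (ltn_esize_bignat _) _; rewrite leq_exp2l //.
      apply: leq_trans (le_f a x) _; rewrite leq_mul2l leq_wexp2r ?orbT //; lia.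
    have : 2 ^ Q a <= 2 ^ (Q a + size s) by rewrite leq_exp2l // leq_addr.
    by lia.
  by rewrite muln1 leq_exp2l // leq_add2l ltnW.
Qed.

Lemma FP_bignat_mul (A : encodable) (f g : A -> nat) :
  FP (fun a => Bignat (f a)) -> FP (fun a => Bignat (g a)) ->
  FP (fun a => Bignat (f a * g a)).
Proof.
move=> Hf Hg; have Hb := FP_bits Hg.
apply: (FP_ext (f := fun a => Bignat (\sum_(k <- iota 0 (size (binary (g a))))
    (if nth false (binary (g a)) k then f a * 2 ^ k else 0)))).
  move=> a; congr Bignat; rewrite -{3}(bitval_binary (g a)).
  elim: (binary _) (f a) => [|b s IH] n; first by rewrite big_nil muln0.
  rewrite /= big_cons -[iota 1 _]/(iota (1 + 0) _) iotaDl big_map /=.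
  under eq_bigr => k _ do rewrite add1n expnS mulnA /=.
  rewrite IH expn0 muln1; by case: b; lia.
apply: FP_bignat_sum (FP_iota (FP_size Hb)) _.
apply: (FP_ext (f := fun p : A * nat => if nth false (binary (g p.1)) p.2
    then Bignat (f p.1 * 2 ^ p.2) else Bignat 0)); first by move=> p; case: nth.
apply: FP_if (FP_const _).
- exact: (FP_nth _ (FP_comp (FP_fst FP_id) Hb) (FP_snd FP_id)).
- exact: (FP_bignat_mul_exp2 (FP_comp (FP_fst FP_id) Hf) (FP_snd FP_id)).
Qed.

Lemma FP_bignat_prod (A B : encodable) (l : A -> seq B) (f : A -> B -> nat) :
  FP l -> FP (fun p : A * B => Bignat (f p.1 p.2)) ->
  FP (fun a => Bignat (\prod_(x <- l a) f a x)).
Proof.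
move=> Hl Hf; have [c [d le_f]] := FP_esize2 (f := fun a b => Bignat (f a b)) Hf.
pose g a z x := Bignat (bigval z * f a x).
have E a s : foldl (g a) (Bignat 1) s = Bignat (\prod_(x <- s) f a x).
  elim/last_ind: s => [|s x IH]; first by rewrite big_nil.
  by rewrite foldl_rcons IH -cats1 big_cat big_seq1.
apply: (FP_ext (f := fun a => foldl (g a) (Bignat 1) (l a))) => [a|]; first by rewrite E.
pose Q a := c * (esize a + esize (l a) + 1) ^ d.
apply: (FP_foldl (g := g) (b := fun a => 4 * (Q a * esize (l a) + 1) + 1)) => //.
- exact: FP_const.
- apply: FP_bignat_mul; first exact: (FP_snd (FP_fst FP_id)).
  exact: (FP_comp (FP_pair (FP_fst (FP_fst FP_id)) (FP_snd FP_id)) Hf).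
- by have := FP_esize Hl => ?; rewrite /Q; pbound; apply: poly_bounded_size.
- move=> a j; rewrite E; apply: esize_bignat; rewrite addn1.
  have : esize (take j (l a)) <= esize (l a) by exact: esize_take.
  have : size (take j (l a)) <= esize (l a).
    by apply: ltnW; apply: leq_trans (size_le_esize _) (esize_take _ _).
  move: (take j (l a)) => s lt_s le_s.
  apply: (@leq_ltn_trans (2 ^ (Q a * size s))); last first.
    by rewrite ltn_exp2l // ltnS leq_mul2l lt_s orbT.
  elim: s le_s {lt_s} => [|x s IH]; first by rewrite big_nil expn_gt0.
  rewrite esize_cons big_cons /= mulnS expnD => le_s.
  rewrite leq_mul // ?IH //; last lia.
  apply: ltnW; apply: leq_trans (ltn_esize_bignat _) _; rewrite leq_exp2l //.
  apply: leq_trans (le_f a x) _; rewrite leq_mul2l leq_wexp2r ?orbT //; lia.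
Qed.

(** Only this direction is polynomial; therefore quota, labels and actor, which arrive in binary,
    are compared in binary with converted unary numbers. *)
Lemma FP_bignat_of_nat (A : encodable) (n : A -> nat) :
  FP n -> FP (fun a => Bignat (n a)).
Proof.
move=> Hn; apply: (FP_ext (f := fun a => Bignat (\sum_(k <- iota 0 (n a)) 1))).
  by move=> a; rewrite sum1_size size_iota.
exact: (FP_bignat_sum (f := fun _ _ => 1) (FP_iota Hn) (FP_const _)).
Qed.

(** * The spread of influence *)

Section Spread.
Variables (V : finType) (g : influence_game V).
Hypothesis label_gt0 : positive_labels g.

Local Notation P := (predecessors (game_graph g)).

(** In a game graph [Lset] and [Iset] together are the vertices without predecessors, so these are
    the players of a strong hierarchical game. *)
Definition sources : {set V} := [set v | P v == set0].

Lemma spread_step_mono : {homo spread_step g : X Y / X \subset Y}.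
Proof.
move=> X Y sXY; apply: setUSS => //; apply/subsetP => v; rewrite !inE => le_v.
apply: le_trans le_v _. rewrite ler_nat.
by apply: subset_leq_card; apply: setIS.
Qed.

Lemma spread_stepE X v : v \in spread_step g X =
  (v \in X) || (label g v <= #|P v :&: X|%:R)%R.
Proof. by rewrite !inE. Qed.

Lemma label_le0 v : (label g v <= 0)%R = false.
Proof. by apply/negbTE; rewrite -ltNge. Qed.

(** The monotone map [f] reaches its least fixed point from the empty set within #|V| rounds. By
    positivity of the labels its first round yields exactly [X], so its iterates are those of
    [spread_step] shifted by one. *)
Lemma spread_fixed X : spread_step g (spread g X) = spread g X.
Proof.
pose f Y := X :|: spread_step g Y.
have f_mono : {homo f : Y Z / Y \subset Z}.
  by move=> Y Z /spread_step_mono; apply: setUS.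
have f0 : f set0 = X.
  apply/setP => v; rewrite in_setU spread_stepE inE setI0 cards0 label_le0.
  by rewrite !orbF.
have sX k : X \subset iter k (spread_step g) X.
  elim: k => //= k IH; apply: subset_trans IH _; exact: subsetUl.
have Ef k : iter k.+1 f set0 = iter k (spread_step g) X.
  elim: k => // k IH; rewrite iterS IH iterS /f; apply/setUidPr.
  exact: (sX k.+1).
have fixE : fixset f = spread g X by rewrite -(fixsetK f_mono) /fixset -iterS Ef.
have := fixsetK f_mono; rewrite fixE => E.
apply/eqP; rewrite eqEsubset subsetUl andbT -{2}E; exact: subsetUr.
Qed.

Lemma spread_source (X : {set V}) v : v \in sources -> (v \in spread g X) = (v \in X).
Proof.
rewrite inE => /eqP P0; rewrite /spread; elim: #|V| => //= k IH.
by rewrite spread_stepE IH P0 set0I cards0 label_le0 orbF.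
Qed.

(** Such a vertex is not in the seed, so it was activated through its predecessors; the converse is
    the fixed-point equation. For a layer, whose vertices share their predecessors, the number of
    active vertices thus depends only on the number of active predecessors. *)
Lemma spread_nonsource (X : {set V}) v : X \subset sources -> v \notin sources ->
  (v \in spread g X) = (label g v <= #|P v :&: spread g X|%:R)%R.
Proof.
move=> sX Nv; apply/idP/idP => [|le_v]; last first.
  by rewrite -spread_fixed spread_stepE le_v orbT.
have sF k (Y : {set V}) : Y \subset iter k (spread_step g) Y.
  elim: k => //= k IH; apply: subset_trans IH _; exact: subsetUl.
rewrite {1}/spread; have := leqnn #|V|; move: {-2}#|V| => k.
elim: k => [|k IH] le_k /=; first by move/(subsetP sX); rewrite (negbTE Nv).
rewrite spread_stepE => /orP[|le_v]; first exact: IH (ltnW le_k).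
apply: le_trans le_v _; rewrite ler_nat; apply: subset_leq_card; apply: setIS.
by rewrite /spread -(subnK (ltnW le_k)) iterD; apply: sF.
Qed.

(** Influence only travels along edges, so a set closed under predecessors evolves independently of
    the rest. This separates the parts of a disjoint union. *)
Lemma spread_local (D X : {set V}) : (forall v, v \in D -> P v \subset D) ->
  spread g X :&: D = spread g (X :&: D) :&: D.
Proof.
move=> closedD; rewrite /spread; elim: #|V| => [|k IH] /=.
  by rewrite -setIA setIid.
apply/setP => v; rewrite !in_setI; case vD : (v \in D); last by rewrite !andbF.
rewrite !andbT !spread_stepE; move/setP/(_ v): (IH); rewrite !in_setI vD !andbT => ->.
have -> // : forall Y : {set V}, P v :&: Y = P v :&: (Y :&: D).
  by move=> Y; rewrite setICA [RHS]setIC (setIidPl (closedD v vD)).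
by rewrite IH -[in RHS](setIidPl (closedD v vD)) -!setIA [D :&: _]setIC.
Qed.

End Spread.

(** * Kronecker substitution *)

(** The bound on the total weight excludes carries between blocks of z bits: terms with a smaller
    exponent than [b] form the remainder of the division, those with a larger one remain divisible
    by 2^z. *)
Lemma sum_digit (I : finType) (Q : pred I) (w e : I -> nat) z b :
  \sum_(i | Q i) w i < 2 ^ z ->
  ((\sum_(i | Q i) w i * 2 ^ (z * e i)) %/ 2 ^ (z * b)) %% 2 ^ z =
  \sum_(i | Q i && (e i == b)) w i.
Proof.
move=> lt_w.
have Emid : \sum_(i | Q i && (e i == b)) w i * 2 ^ (z * e i) =
    (\sum_(i | Q i && (e i == b)) w i) * 2 ^ (z * b).
  by rewrite big_distrl; apply: eq_bigr => i /andP[_ /eqP ->].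
have [k Ehigh] : exists k, \sum_(i | Q i && (b < e i)) w i * 2 ^ (z * e i) =
    k * 2 ^ z * 2 ^ (z * b).
  exists (\sum_(i | Q i && (b < e i)) w i * 2 ^ (z * (e i - b.+1))).
  rewrite -mulnA -expnD -mulnS mulnC big_distrr; apply: eq_bigr => i /andP[_ lt_b].
  rewrite /= [RHS]mulnC -mulnA -expnD -mulnDr; congr (_ * 2 ^ (_ * _)); lia.
have Elow : \sum_(i | Q i && (e i < b)) w i * 2 ^ (z * e i) < 2 ^ (z * b).
  case: b {Emid Ehigh} => [|b].
    by rewrite big_pred0 ?expn_gt0 // => i; rewrite andbF.
  rewrite mulnS expnD.
  apply: (@leq_ltn_trans ((\sum_(i | Q i) w i) * 2 ^ (z * b))); last first.
    by rewrite ltn_pmul2r // expn_gt0.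
  rewrite big_distrl [X in _ <= X](bigID (fun i => e i < b.+1)) /=.
  apply: leq_trans (leq_addr _ _); apply: leq_sum => i /andP[_ lt_e].
  by rewrite leq_mul2l leq_exp2l // leq_mul2l -ltnS lt_e !orbT.
have -> : \sum_(i | Q i) w i * 2 ^ (z * e i) =
    (k * 2 ^ z + \sum_(i | Q i && (e i == b)) w i) * 2 ^ (z * b) +
    \sum_(i | Q i && (e i < b)) w i * 2 ^ (z * e i).
  rewrite (bigID (fun i => e i < b)) /= addnC; congr (_ + _).
  rewrite (bigID (fun i => e i == b)) /= mulnDl -Ehigh -Emid addnC.
  congr (_ + _); apply: eq_bigl => i; rewrite -andbA; congr (_ && _); lia.
rewrite divnMDl ?expn_gt0 // (divn_small Elow) addn0 modnMDl modn_small //.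
apply: leq_ltn_trans lt_w; rewrite [X in _ <= X](bigID (fun i => e i == b)) /=.
exact: leq_addr.
Qed.

(** * The algorithm *)

(* Y = 2^ywidth and Z = 2^zwidth: at most 2^n terms Y^a with a <= n sum up to
   less than Z, so the digits in base Z do not overlap. *)
Definition ywidth n := n.+1.
Definition zwidth n := n.+1 * n.+1.

(* Adding a layer in which [c b] vertices become active as soon as b vertices of
   FI(H) are active: Y^a Z^b becomes Y^a (Y Z)^(c b). *)
Definition collapse n (p : nat) (c : nat -> nat) : nat :=
  \sum_(b <- iota 0 n.+1)
    ((p %/ 2 ^ (zwidth n * b)) %% 2 ^ zwidth n) *
    2 ^ ((ywidth n + zwidth n) * c b).

Section Algorithm.
Variable fs : seq (seq bool).

(** The length of the first matrix row gives the number of vertices in unary, whereas field 0 holds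
    it in binary. *)
Definition order : nat := size (nth [::] fs 1).
Definition edge (u v : nat) : bool := nth false (nth [::] fs u.+1) v.
(** With n vertices, fields 1 to n are the matrix rows; the numerators start at n + 1, the
    denominators at 2n + 1, the quota is field 3n + 2 and the actor field 3n + 3. *)
Definition label_num (u : nat) : nat := bitval (nth [::] fs (order + u).+1).
Definition label_den (u : nat) : nat :=
  bitval (nth [::] fs (order + order + u).+1).
Definition threshold : nat := bitval (nth [::] fs (order + order + order).+2).
Definition actor : nat := bitval (nth [::] fs (order + order + order).+3).

Definition source u := all (fun w => ~~ edge w u) (iota 0 order).
Definition sink u := all (fun w => ~~ edge u w) (iota 0 order).
Definition same_pred u w := all (fun k => edge k u == edge k w) (iota 0 order).
(* Two non-source vertices with the same predecessors lie in the same layer, of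
   which only the least vertex is counted. *)
Definition canonical u := ~~ has (fun w => same_pred u w) (iota 0 u).

Definition activated u b : nat :=
  count (fun w => same_pred u w && (label_num w <= b * label_den w))
    (iota 0 order).

(** The polynomial 1 + YZ of a single source, which counts in both exponents when active; forcing
    the actor keeps one of the two terms. *)
Definition weight fb u : nat :=
  if u == actor then (if fb then 2 ^ (ywidth order + zwidth order) else 1)
  else 1 + 2 ^ (ywidth order + zwidth order).

Definition factor fb (T : seq bignat) u : nat :=
  if source u then weight fb u
  else if canonical u then bigval (nth (Bignat 0) T u) else 1.

Definition product fb T (S : nat -> bool) : nat :=
  \prod_(u <- iota 0 order) (if S u then factor fb T u else 1).

(* The truncation is void on strong hierarchical graphs; it keeps the numbers
   small on all inputs. *)
Definition entry fb T u : nat :=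
  collapse order (product fb T (fun w => edge w u)) (activated u)
    %% 2 ^ (zwidth order * order.+1).

Definition table fb t : seq bignat :=
  iter t (fun T => [seq Bignat (entry fb T u) | u <- iota 0 order]) [::].

(** Collapsing with the constant 0 sets Z = 1 and leaves a function of Y. *)
Definition total fb : nat :=
  collapse order (product fb (table fb order) sink) (fun _ => 0).

Definition coefficient fb a : nat :=
  (total fb %/ 2 ^ (ywidth order * a)) %% 2 ^ ywidth order.

Definition satisfaction : nat :=
  (\sum_(a <- iota 0 order.+1) coefficient (threshold <= a) a) *
  2 ^ count (fun u => ~~ source u && ~~ (u == actor)) (iota 0 order).

End Algorithm.

(** * Correctness *)

Lemma big_iota R (idx : R) op n (F : nat -> R) :
  \big[op/idx]_(k <- iota 0 n) F k = \big[op/idx]_(k < n) F k.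
Proof. by rewrite -(big_mkord xpredT) /index_iota subn0. Qed.

Lemma all_iota (p : pred nat) n : all p (iota 0 n) = [forall k : 'I_n, p k].
Proof.
apply/allP/forallP => [H k|H k]; first by apply: H; rewrite mem_iota /=.
by rewrite mem_iota /= => lt_k; apply: (H (Ordinal lt_k)).
Qed.

Lemma count_iota (p : pred nat) n :
  count p (iota 0 n) = #|[set k : 'I_n | p k]|.
Proof. by rewrite -sum1_count big_mkcond big_iota -big_mkcond sum1dep_card. Qed.

(** * Generating functions of vertex sets *)

Section Correctness.
Variables (n : nat) (g : influence_game 'I_n) (i0 : 'I_n).
Hypothesis label_gt0 : positive_labels g.

Local Notation P := (predecessors (game_graph g)).
Local Notation F := (spread g).
Local Notation N := (sources g).
Local Notation yw := (ywidth n).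
Local Notation zw := (zwidth n).

(** The implication makes the forcing void when the actor is not a source in [D]; thus each part of
    a disjoint union can be treated with the same [fb]. *)
Definition admissible fb (D X : {set 'I_n}) : bool :=
  (X \subset N :&: D) && ((i0 \in N :&: D) ==> ((i0 \in X) == fb)).

(* X ranges over the sets of initially active sources of D, the choice of the
   actor being forced to [fb]. *)
Definition gf fb (D S : {set 'I_n}) : nat :=
  \sum_(X | admissible fb D X) 2 ^ (yw * #|F X :&: D| + zw * #|F X :&: S|).

Lemma card_ord_le (X : {set 'I_n}) : #|X| <= n.
Proof. by rewrite -[n in _ <= n]card_ord max_card. Qed.

Lemma sum_ybound (Q : pred {set 'I_n}) (D : {set 'I_n}) :
  \sum_(X | Q X) 2 ^ (yw * #|F X :&: D|) < 2 ^ zw.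
Proof.
apply: (@leq_ltn_trans (\sum_(X : {set 'I_n}) 2 ^ (yw * n))).
  rewrite [X in _ <= X](bigID Q) /=; apply: leq_trans (leq_addr _ _).
  by apply: leq_sum => X _; rewrite leq_exp2l // leq_mul2l card_ord_le orbT.
(* The sum is 2^(n + (n + 1)n), and this exponent is one less than (n + 1)^2 = [zwidth n]. *)
rewrite sum_nat_const -cardsT -powersetT card_powerset cardsT card_ord -expnD ltn_exp2l // /ywidth /zwidth; lia.
Qed.

(** Under this bound the truncation in [entry] is the identity. *)
Lemma gf_ub fb D S : gf fb D S < 2 ^ (zw * n.+1).
Proof.
apply: (@leq_ltn_trans ((\sum_(X | admissible fb D X) 2 ^ (yw * #|F X :&: D|)) *
   2 ^ (zw * n))).
  rewrite big_distrl; apply: leq_sum => X _; rewrite expnD leq_mul2l leq_exp2l //.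
  by rewrite leq_mul2l card_ord_le !orbT.
by rewrite mulnS expnD ltn_pmul2r ?expn_gt0 ?sum_ybound.
Qed.

(** Group the sets X by b = |F X :&: S|: the digit at position b in base Z is the sum of the powers
    of Y over that group. *)
Lemma collapse_gf fb D S c : collapse n (gf fb D S) c =
  \sum_(X | admissible fb D X)
    2 ^ (yw * #|F X :&: D| + (yw + zw) * c #|F X :&: S|).
Proof.
rewrite /collapse big_iota.
rewrite (partition_big (fun X => inord #|F X :&: S| : 'I_n.+1) xpredT) //=.
apply: eq_bigr => b _.
have -> : gf fb D S = \sum_(X | admissible fb D X)
    2 ^ (yw * #|F X :&: D|) * 2 ^ (zw * #|F X :&: S|).
  by apply: eq_bigr => X _; rewrite expnD.
rewrite sum_digit ?sum_ybound // big_distrl.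
have E X : (inord #|F X :&: S| == b) = (#|F X :&: S| == b :> nat).
  by rewrite -val_eqE /= inordK // ltnS card_ord_le.
by apply: eq_big => X; rewrite ?E // => /andP[_ /eqP ->]; rewrite expnD.
Qed.

(** Expand the product of the [on u + off u] over the sets J of active vertices. A set J that is not
    admissible picks a zero factor, either outside [A] or at the actor; sources are active exactly
    when chosen. *)
Lemma gf_isolated fs fb (A : {set 'I_n}) :
  order fs = n -> actor fs = i0 -> A \subset N ->
  \prod_(u in A) weight fs fb u = gf fb A A.
Proof.
move=> order_fs actor_fs sAN; pose c := 2 ^ (yw + zw).
pose on (u : 'I_n) := if (u \in A) && ((u == i0) ==> fb) then c else 0.
pose off (u : 'I_n) := if [&& u \in A, u == i0 & fb] then 0 else 1.
have -> : \prod_(u in A) weight fs fb u = \prod_u (on u + off u).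
  rewrite big_mkcond; apply: eq_bigr => u _; rewrite /weight order_fs actor_fs.
  rewrite /on /off -/c -[val u == val i0]/(u == i0).
  by case: (u \in A); case: (u == i0); case: fb {on off}; rewrite ?addn0 ?add0n // addnC.
rewrite bigA_distr /gf [RHS]big_mkcond; apply: eq_bigr => J _.
rewrite /admissible (setIidPr sAN).
case: ifP => [/andP[sJA /implyP HJ]|notadm].
  have EJ : F J :&: A = J.
    apply/setP => u; rewrite in_setI; case uA : (u \in A).
      by rewrite andbT spread_source // (subsetP sAN).
    by rewrite andbF; apply/esym/negbTE; apply: contraFN uA; apply: (subsetP sJA).
  rewrite EJ -mulnDl expnM -/c -prod_nat_const [RHS]big_mkcond.
  apply: eq_bigr => u _; rewrite /on /off.
  have [-> | _] := eqVneq u i0; last first.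
    by case: ifP => uJ; rewrite ?(subsetP sJA _ uJ) //= andbF.
  case: ifP => uJ; last first.
    by case uA : (i0 \in A) => //=; rewrite -(eqP (HJ uA)) uJ.
  by have uA := subsetP sJA _ uJ; rewrite uA /= -(eqP (HJ uA)) uJ.
have [sJA|/subsetPn[u uJ uA]] := boolP (J \subset A); last first.
  by rewrite (bigD1 u) //= uJ /on (negbTE uA).
move: notadm; rewrite sJA /= => /negbT; rewrite negb_imply => /andP[iA ne].
rewrite (bigD1 i0) //= /on /off iA eqxx /=.
by case: (i0 \in J) ne; case: fb {on off}.
Qed.

(** A set X corresponds to the pair of its traces on [D1] and [D2], and by [spread_local] the spread
    on each part depends on the trace there only. *)
Lemma gf_union fb (D1 D2 S1 S2 : {set 'I_n}) :
  [disjoint D1 & D2] -> (forall v, v \in D1 -> P v \subset D1) ->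
  (forall v, v \in D2 -> P v \subset D2) -> S1 \subset D1 -> S2 \subset D2 ->
  gf fb (D1 :|: D2) (S1 :|: S2) = gf fb D1 S1 * gf fb D2 S2.
Proof.
move=> dis cl1 cl2 sS1 sS2; rewrite /gf big_distrlr pair_big /=.
have D12 u : u \in D1 -> (u \in D2) = false by exact: disjointFr.
rewrite (reindex_onto (fun X => (X :&: D1, X :&: D2)) (fun p => p.1 :|: p.2)); last first.
  move=> [X1 X2] /= /andP[/andP[s1 _] /andP[s2 _]].
  congr (_, _); apply/setP => u; rewrite !inE.
    case u1 : (u \in X1); first by have := subsetP s1 _ u1; rewrite inE => /andP[_ ->].
    case u2 : (u \in X2) => //=; have := subsetP s2 _ u2; rewrite inE => /andP[_ h].
    by rewrite (disjointFl dis).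
  case u2 : (u \in X2); first by have := subsetP s2 _ u2; rewrite inE orbT => /andP[_ ->].
  case u1 : (u \in X1) => //=; have := subsetP s1 _ u1; rewrite inE => /andP[_ h].
  by rewrite (disjointFr dis).
apply: eq_big => [X | X _] /=.
  have -> : (X :&: D1 :|: X :&: D2 == X) = (X \subset D1 :|: D2).
    by rewrite -setIUr; apply/eqP/setIidPl.
  rewrite /admissible; apply/idP/idP.
    move=> /andP[sX Hi]; move: sX Hi; rewrite subsetI => /andP[sN sD] Hi.
    rewrite sD andbT !subsetI !subsetIr !andbT !(subset_trans (subsetIl _ _) sN) /=.
    move: Hi; rewrite !inE; case: (P i0 == set0) => //=.
    by case: (i0 \in X) (i0 \in D1) (i0 \in D2) fb => -[] [] [].
  move=> /andP[/andP[/andP[s1 i1] /andP[s2 i2]] sD].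
  rewrite subsetI sD andbT; apply/andP; split.
    apply/subsetP => u uX; have := subsetP sD u uX; rewrite in_setU => /orP[h|h].
      by have := subsetP s1 u; rewrite !in_setI uX h => /(_ isT)/andP[].
    by have := subsetP s2 u; rewrite !in_setI uX h => /(_ isT)/andP[].
  move: i1 i2; rewrite !inE; case: (P i0 == set0) => //=.
  by case: (i0 \in X) (i0 \in D1) (i0 \in D2) fb => -[] [] [].
have loc (D S : {set 'I_n}) : (forall v, v \in D -> P v \subset D) -> S \subset D ->
    F X :&: S = F (X :&: D) :&: S.
  by move=> cl sS; rewrite -(setIidPr sS) !setIA spread_local.
rewrite -(loc D1 D1) // -(loc D2 D2) // -(loc D1 S1) // -(loc D2 S2) //.
rewrite !setIUr !cardsU -expnD.
have -> : F X :&: D1 :&: (F X :&: D2) = set0.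
  by apply/setP => u; rewrite !inE; case h : (u \in D1); rewrite ?(D12 u h) ?andbF.
have -> : F X :&: S1 :&: (F X :&: S2) = set0.
  apply/setP => u; rewrite !inE; case h : (u \in S1); rewrite ?andbF //.
  have /negbTE -> : u \notin S2; last by rewrite !andbF.
  by apply: contraFN (D12 u (subsetP sS1 _ h)); apply: (subsetP sS2).
by rewrite cards0 !subn0 !mulnDr addnACA.
Qed.

(** Since [S] is nonempty, [B] contains no source and X ranges over the same sets on both sides. The
    active vertices of [B] number [c] of |F X :&: S| and count in both exponents, hence the width
    [yw + zw] in [collapse]. *)
Lemma gf_extend fb (D S B : {set 'I_n}) (c : nat -> nat) :
  [disjoint D & B] -> S != set0 -> (forall b, b \in B -> P b = S) ->
  (forall k, c k = #|[set b in B | (label g b <= k%:R)%R]|) ->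
  gf fb (D :|: B) B = collapse n (gf fb D S) c.
Proof.
move=> dis S0 PB cE; rewrite collapse_gf /gf.
have BN b : b \in B -> b \notin N by move=> bB; rewrite inE PB.
have ND : N :&: (D :|: B) = N :&: D.
  apply/setP => u; rewrite !in_setI in_setU; case uB : (u \in B); last by rewrite orbF.
  by rewrite (negbTE (BN u uB)).
apply: eq_big => [X|X]; rewrite /admissible ND // => /andP[].
rewrite subsetI => /andP[sXN _] _.
have -> : #|F X :&: B| = c #|F X :&: S|.
  rewrite cE; apply: eq_card => b; rewrite !inE andbC; case bB : (b \in B) => //=.
  by rewrite spread_nonsource ?BN // PB // setIC.
rewrite setIUr cardsU.
have -> : F X :&: D :&: (F X :&: B) = set0.
  by apply/setP => u; rewrite !inE; case h : (u \in D); rewrite ?(disjointFr dis h) ?andbF.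
have -> : #|F X :&: B| = c #|F X :&: S|.
  rewrite cE; apply: eq_card => b; rewrite !inE andbC; case bB : (b \in B) => //=.
  by rewrite spread_nonsource ?BN // PB // setIC.
by rewrite cards0 subn0; congr (2 ^ _); lia.
Qed.

(** * Recovering the layers from predecessor sets *)

Section Recursion.
Variable fs : seq (seq bool).
Hypothesis order_fs : order fs = n.
Hypothesis edge_fs : forall u v : 'I_n, edge fs u v = ((u, v) \in game_edges g).
Hypothesis label_fs : forall (u : 'I_n) b,
  (label_num fs u <= b * label_den fs u) = (label g u <= b%:R)%R.
Hypothesis actor_fs : actor fs = i0.

Lemma edgeE (u v : 'I_n) : edge fs u v = (u \in P v).
Proof. by rewrite edge_fs !inE. Qed.

Lemma sourceE (u : 'I_n) : source fs u = (u \in N).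
Proof.
rewrite /source order_fs all_iota inE; apply/forallP/eqP => [H|P0 w].
  by apply/setP => w; rewrite in_set0 -edgeE; apply/negbTE/H.
by rewrite edgeE P0 in_set0.
Qed.

Lemma same_predE (u w : 'I_n) : same_pred fs u w = (P u == P w).
Proof.
rewrite /same_pred order_fs all_iota; apply/forallP/eqP => [H|E k].
  by apply/setP => k; rewrite -!edgeE; apply/eqP/H.
by rewrite !edgeE E.
Qed.

Lemma canonicalE (u : 'I_n) :
  reflect (forall w : 'I_n, w < u -> P w <> P u) (canonical fs u).
Proof.
apply: (iffP hasPn) => [H w lt_w E|H w].
  by have := H w; rewrite mem_iota /= lt_w same_predE E eqxx => /(_ isT).
rewrite mem_iota /= => lt_w; have lt_n := ltn_trans lt_w (ltn_ord u).
rewrite -[w]/(val (Ordinal lt_n)) same_predE; apply/eqP => E.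
exact: (H (Ordinal lt_n) lt_w (esym E)).
Qed.

Lemma activatedE (u : 'I_n) b :
  activated fs u b = #|[set w | (P u == P w) && (label g w <= b%:R)%R]|.
Proof.
rewrite /activated order_fs count_iota; apply: eq_card => w.
by rewrite !inE same_predE label_fs.
Qed.

Lemma productE fb T (S : nat -> bool) (A : {set 'I_n}) :
  (forall u : 'I_n, S u = (u \in A)) ->
  product fs fb T S = \prod_(u in A) factor fs fb T u.
Proof.
move=> SA; rewrite /product order_fs big_iota [RHS]big_mkcond.
by apply: eq_bigr => u _; rewrite SA.
Qed.

Lemma nth_table fb t (u : 'I_n) :
  bigval (nth (Bignat 0) (table fs fb t.+1) u) = entry fs fb (table fs fb t) u.
Proof.
by rewrite /= (nth_map 0) ?size_iota order_fs // nth_iota.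
Qed.

Lemma FIsetE (H : digraph 'I_n) v :
  (v \in FIset H) = (v \in verts H) && (successors H v == set0).
Proof.
rewrite !inE; case: (v \in verts H) => //=.
by case: (successors H v == set0) => //=; case: eqP.
Qed.

Lemma sh_edges (H : digraph 'I_n) : strong_hierarchical H ->
  forall u v, (u, v) \in edges H -> (u \in verts H) && (v \in verts H).
Proof.
elim=> /= [A _|H1 H2 _ E1 _ E2 _|H1 B _ E1 _ _] u v; rewrite ?in_setU.
- by rewrite in_set0.
- by move=> /orP[/E1|/E2] /andP[-> ->]; rewrite ?orbT.
- move=> /orP[/E1 /andP[-> ->] //|]; rewrite in_setX => /andP[].
  by rewrite FIsetE => /andP[-> _] ->; rewrite orbT.
Qed.

(* Under this condition the predecessor sets of the whole game graph determine
   the layers from which H was built. *)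
Definition embedded (H : digraph 'I_n) : Prop :=
  (forall v, v \in verts H -> P v = predecessors H v) /\
  (forall v w, v \in verts H -> P v != set0 -> P w = P v -> w \in verts H).

Lemma embedded_closed H v : embedded H -> v \in verts H -> P v \subset verts H.
Proof.
by case=> HP _ vH; rewrite HP //; apply/subsetP => u; rewrite inE => /andP[].
Qed.

Definition disjoint_union (H1 H2 : digraph 'I_n) : digraph 'I_n :=
  Digraph (verts H1 :|: verts H2) (edges H1 :|: edges H2).

Lemma disjoint_unionC H1 H2 : disjoint_union H1 H2 = disjoint_union H2 H1.
Proof. by rewrite /disjoint_union setUC [edges _ :|: _]setUC. Qed.

Lemma union_predecessors H1 H2 v : strong_hierarchical H1 -> strong_hierarchical H2 ->
  [disjoint verts H1 & verts H2] -> v \in verts H1 ->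
  predecessors (disjoint_union H1 H2) v = predecessors H1 v.
Proof.
move=> sh1 sh2 dis v1; apply/setP => u; rewrite !inE /=.
have -> : ((u, v) \in edges H2) = false.
  by apply/negP => /(sh_edges sh2) /andP[_]; rewrite (disjointFr dis).
rewrite orbF; case E : (_ \in edges H1); rewrite ?andbF // !andbT.
by have /andP[-> _] := sh_edges sh1 E.
Qed.

Lemma union_successors H1 H2 v : strong_hierarchical H1 -> strong_hierarchical H2 ->
  [disjoint verts H1 & verts H2] -> v \in verts H1 ->
  successors (disjoint_union H1 H2) v = successors H1 v.
Proof.
move=> sh1 sh2 dis v1; apply/setP => u; rewrite !inE /=.
have -> : ((v, u) \in edges H2) = false.
  by apply/negP => /(sh_edges sh2) /andP[]; rewrite (disjointFr dis).
rewrite orbF; case E : (_ \in edges H1); rewrite ?andbF // !andbT.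
by have /andP[_ ->] := sh_edges sh1 E.
Qed.

(** A vertex of [H2] with the same nonempty predecessor set as one of [H1] would give a predecessor
    belonging to both disjoint parts. *)
Lemma embedded_union H1 H2 : strong_hierarchical H1 -> strong_hierarchical H2 ->
  [disjoint verts H1 & verts H2] -> embedded (disjoint_union H1 H2) ->
  embedded H1.
Proof.
move=> sh1 sh2 dis [HP Hsame].
have HP1 v : v \in verts H1 -> P v = predecessors H1 v.
  move=> v1; rewrite -(union_predecessors sh1 sh2) //.
  by apply: HP; rewrite in_setU v1.
split=> // v w v1 P0 Pwv.
have := Hsame v w; rewrite !in_setU v1 => /(_ isT P0 Pwv) /orP[//|w2].
have [u uP] := set0Pn _ P0.
have u1 : u \in verts H1 by move: uP; rewrite HP1 // inE => /andP[].
move: uP; rewrite -Pwv HP; last by rewrite in_setU w2 orbT.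
rewrite disjoint_unionC union_predecessors //; last by rewrite disjoint_sym.
by rewrite inE (disjointFr dis u1).
Qed.

Lemma FIset_union H1 H2 : strong_hierarchical H1 -> strong_hierarchical H2 ->
  [disjoint verts H1 & verts H2] ->
  FIset (disjoint_union H1 H2) = FIset H1 :|: FIset H2.
Proof.
move=> sh1 sh2 dis; apply/setP => v; rewrite in_setU !FIsetE /= in_setU.
case v1 : (v \in verts H1).
  by rewrite /= union_successors // (disjointFr dis v1) orbF.
case v2 : (v \in verts H2) => //=.
by rewrite disjoint_unionC union_successors // disjoint_sym.
Qed.

Definition extension (H : digraph 'I_n) (B : {set 'I_n}) : digraph 'I_n :=
  Digraph (verts H :|: B) (edges H :|: setX (FIset H) B).

Section Extension.
Variables (H : digraph 'I_n) (B : {set 'I_n}).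
Hypotheses (shH : strong_hierarchical H) (B0 : B != set0).
Hypotheses (dis : [disjoint verts H & B]) (embE : embedded (extension H B)).

Lemma extension_predecessors v : v \in verts H ->
  predecessors (extension H B) v = predecessors H v.
Proof.
move=> vH; apply/setP => u; rewrite !inE /= (disjointFr dis vH) andbF orbF.
case E : (_ \in edges H); rewrite ?andbF // !andbT.
by have /andP[-> _] := sh_edges shH E.
Qed.

Lemma extension_new b : b \in B -> P b = FIset H.
Proof.
move=> bB; rewrite embE.1; last by rewrite in_setU bB orbT.
apply/setP => u; rewrite [LHS]inE [X in X && _]in_setU [X in _ && X]in_setU.
rewrite in_setX /= bB andbT.
have -> : ((u, b) \in edges H) = false.
  by apply/negP => /(sh_edges shH) /andP[_]; rewrite (disjointFl dis).
case uF : (u \in FIset H); rewrite ?andbF //=.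
by move: uF; rewrite FIsetE => /andP[->].
Qed.

(** A vertex of [FIset H] has no successor in [H], so it cannot precede [v]. Hence old layers never
    share predecessors with the new one. *)
Lemma extension_old v : v \in verts H -> P v = FIset H -> P v = set0.
Proof.
move=> vH PvE; apply/eqP; apply: contraT => /set0Pn[u uP].
have : u \in FIset H by rewrite -PvE.
rewrite FIsetE => /andP[uH /eqP/setP/(_ v)]; rewrite !inE vH /=.
move: uP; rewrite embE.1; last by rewrite in_setU vH.
by rewrite extension_predecessors // inE uH => /= ->.
Qed.

Lemma embedded_extension : embedded H.
Proof.
have HP v : v \in verts H -> P v = predecessors H v.
  move=> vH; rewrite -extension_predecessors //.
  by apply: embE.1; rewrite in_setU vH.
split=> // v w vH P0 Pwv.
have := embE.2 v w; rewrite !in_setU vH => /(_ isT P0 Pwv) /orP[//|wB].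
by move: P0; rewrite extension_old ?eqxx // -Pwv extension_new.
Qed.

(** As [B] is nonempty, each vertex of [FIset H] acquires a successor, while the other vertices of
    [H] keep theirs. *)
Lemma FIset_extension : FIset (extension H B) = B.
Proof.
have [b bB] := set0Pn _ B0.
apply/setP => v; rewrite FIsetE /= in_setU.
case vB : (v \in B).
  rewrite orbT; apply/eqP/setP => u; rewrite !inE /=.
  have -> : ((v, u) \in edges H) = false.
    by apply/negP => /(sh_edges shH) /andP[]; rewrite (disjointFl dis).
  have -> : (v \in verts H) = false by rewrite (disjointFl dis).
  by rewrite !andbF.
rewrite orbF; case vH : (v \in verts H) => //=; apply/negP => /eqP S0.
have vFI : v \in FIset H.
  rewrite FIsetE vH; apply/eqP/setP => u; rewrite in_set0; apply/negP => uS.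
  move/setP/(_ u): S0; rewrite in_set0 => /negP; apply.
  by move: uS; rewrite !inE /= => /andP[-> ->].
move/setP/(_ b): S0; rewrite in_set0 => /negP; apply.
rewrite [_ \in successors _ _]inE [X in X && _]in_setU [X in _ && X]in_setU.
by rewrite in_setX /= vFI bB !orbT.
Qed.

End Extension.

Lemma FIset_isolated (A : {set 'I_n}) : FIset (Digraph A set0) = A.
Proof.
apply/setP => v; rewrite FIsetE /=; case: (v \in A) => //=.
by apply/eqP/setP => u; rewrite !inE andbF.
Qed.

(** This ensures that a layer added above [H] contains no sources. *)
Lemma FIset_nonempty (H : digraph 'I_n) : strong_hierarchical H -> FIset H != set0.
Proof.
elim=> [A A0|H1 H2 sh1 F1 sh2 _ dis|H1 B sh1 _ B0 dis].
- by rewrite FIset_isolated.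
- rewrite (FIset_union sh1 sh2 dis).
  by apply: contra F1; rewrite setU_eq0 => /andP[].
- by rewrite (FIset_extension sh1 B0 dis).
Qed.

Lemma factor_source fb T (u : 'I_n) : u \in N -> factor fs fb T u = weight fs fb u.
Proof. by move=> uN; rewrite /factor sourceE uN. Qed.

(** Induction on the construction, for all sufficiently late rounds at once, since the parts of a
    union are smaller but use the same table. An extension consumes one round: its entry is computed
    from the preceding table, where [H] is already correct. *)
Lemma product_gf fb (H : digraph 'I_n) : strong_hierarchical H -> embedded H ->
  forall t, #|verts H| <= t ->
  \prod_(u in FIset H) factor fs fb (table fs fb t) u = gf fb (verts H) (FIset H).
Proof.
elim=> {H} [A A0|H1 H2 sh1 IH1 sh2 IH2 dis|H B sh IH B0 dis] emb t le_t.
- rewrite FIset_isolated; have sAN : A \subset N.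
    apply/subsetP => u uA; rewrite inE emb.1 //.
    by apply/eqP/setP => w; rewrite !inE andbF.
  rewrite -(gf_isolated fb order_fs actor_fs sAN).
  by apply: eq_bigr => u /(subsetP sAN) /factor_source.
- rewrite -/(disjoint_union H1 H2) in emb *.
  have dis' : [disjoint verts H2 & verts H1] by rewrite disjoint_sym.
  have emb1 := embedded_union sh1 sh2 dis emb.
  have emb2 : embedded H2.
    by apply: (embedded_union sh2 sh1 dis'); rewrite disjoint_unionC.
  have sFI (K : digraph 'I_n) : FIset K \subset verts K.
    by apply/subsetP => v; rewrite FIsetE => /andP[].
  have disFI : [disjoint FIset H1 & FIset H2] := disjointW (sFI H1) (sFI H2) dis.
  rewrite FIset_union // (eq_bigl [in [predU FIset H1 & FIset H2]]); last first.
    by move=> u; rewrite in_setU.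
  rewrite bigU //.
  rewrite gf_union // ?IH1 ?IH2 //.
  + by apply: leq_trans le_t; apply: subset_leq_card; apply: subsetUr.
  + by apply: leq_trans le_t; apply: subset_leq_card; apply: subsetUl.
  + by move=> v; apply: embedded_closed.
  + by move=> v; apply: embedded_closed.
- rewrite -/(extension H B) in emb *.
  have Bnew := extension_new sh dis emb; have embH := embedded_extension sh dis emb.
  have FI0 := FIset_nonempty sh.
  rewrite FIset_extension //=.
  (* The layer is nonempty, so a round is left for it. *)
  have lt_t : #|verts H| < t.
    apply: leq_trans le_t; rewrite /= cardsU (disjoint_setI0 dis) cards0 subn0.
    by rewrite -[X in X < _]addn0 ltn_add2l card_gt0.
  case: t {le_t} lt_t => // t; rewrite ltnS => le_t.
  (* Together with [Bnew] this makes [B] a full class of equal predecessor sets, as counted by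
     [activated] and represented by its [canonical] vertex. *)
  have layer b w : b \in B -> P w = P b -> w \in B.
    move=> bB Pwb; have := emb.2 b w; rewrite !in_setU bB orbT.
    rewrite (Bnew b bB) => /(_ isT FI0); rewrite -(Bnew b bB) => /(_ Pwb).
    case/orP => // wH; move: FI0; rewrite -(Bnew b bB) -Pwb.
    by rewrite (extension_old sh dis emb) ?eqxx // Pwb (Bnew b bB).
  have [b0 b0B] := set0Pn _ B0.
  (* The representative of the layer; all other vertices of [B] contribute the factor 1. *)
  pose b := [arg min_(w < b0 in B) val w].
  have [bB bmin] : b \in B /\ forall w, w \in B -> b <= w.
    by rewrite /b; case: arg_minnP.
  rewrite (bigD1 b) //= big1 ?muln1; last first.
    move=> w /andP[wB ne_wb]; rewrite /factor sourceE inE (Bnew w wB) (negbTE FI0).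
    case: canonicalE => // /(_ b) []; last by rewrite !Bnew.
    by rewrite ltn_neqAle bmin // andbT; apply: contra ne_wb => /eqP/val_inj ->.
  rewrite /factor sourceE inE (Bnew b bB) (negbTE FI0).
  have -> : canonical fs b.
    apply/canonicalE => w lt_w Pwb; have := bmin w (layer b w bB Pwb).
    by rewrite leqNgt lt_w.
  rewrite nth_table /entry order_fs (productE _ _ (A := FIset H)); last first.
    by move=> u; rewrite edgeE (Bnew b bB).
  rewrite IH // -(gf_extend fb (c := activated fs b) dis FI0 Bnew) ?modn_small ?gf_ub //.
  move=> k; rewrite activatedE; apply: eq_card => w; rewrite !inE; congr (_ && _).
  apply/eqP/idP => [E|wB]; first exact: (layer b).
  by rewrite !Bnew.
Qed.

Lemma embedded_game : embedded (game_graph g).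
Proof. by split=> // v w _ _ _; rewrite in_setT. Qed.

Lemma sinkE (u : 'I_n) : sink fs u = (u \in FIset (game_graph g)).
Proof.
rewrite /sink order_fs all_iota FIsetE in_setT; apply/forallP/eqP => [H|S0 w].
  by apply/setP => w; rewrite !inE -edge_fs; apply/negbTE/H.
by move/setP/(_ w): S0; rewrite !inE -edge_fs => /= ->.
Qed.

(** * From coefficients to the satisfaction *)

Hypothesis strong_g : strong_hierarchical (game_graph g).

Lemma totalE fb : total fs fb =
  \sum_(X | admissible fb setT X) 2 ^ (yw * #|F X|).
Proof.
rewrite /total order_fs (productE _ _ sinkE).
rewrite (product_gf fb strong_g embedded_game); last by rewrite cardsT card_ord.
rewrite collapse_gf; apply: eq_bigr => X _.
by rewrite setIT muln0 addn0.
Qed.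

Lemma coefficientE fb a : coefficient fs fb a =
  #|[set X | admissible fb setT X && (#|F X| == a)]|.
Proof.
rewrite /coefficient totalE order_fs -sum1dep_card.
rewrite (eq_bigr (fun X => 1 * 2 ^ (yw * #|F X|))); last by move=> X _; rewrite mul1n.
rewrite sum_digit // sum1_card; apply: leq_ltn_trans (max_card _) _.
by rewrite -cardsT -powersetT card_powerset cardsT card_ord ltn_exp2l.
Qed.

(** For the sets counted by the coefficient of Y^a the outcome is [q <= a], so forcing the actor to
    that value is forcing it to agree with the outcome. *)
Lemma sum_coefficients q :
  \sum_(a <- iota 0 n.+1) coefficient fs (q <= a) a =
  #|[set X | admissible (q <= #|F X|) setT X]|.
Proof.
rewrite big_iota -[RHS]sum1dep_card.
rewrite (partition_big (fun X => inord #|F X| : 'I_n.+1) xpredT) //=.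
apply: eq_bigr => a _; rewrite coefficientE -sum1dep_card; apply: eq_bigl => X.
have -> : (inord #|F X| == a) = (#|F X| == a :> nat).
  by rewrite -val_eqE /= inordK // ltnS card_ord_le.
by case: eqP => [->|]; rewrite ?andbT ?andbF.
Qed.

(** Split X into its sources and its non-sources other than [i0]; the latter are arbitrary because
    the outcome only sees [X :&: N]. *)
Lemma card_decisions q :
  #|[set X : {set 'I_n} | (q <= #|F (X :&: N)|) == (i0 \in X)]| =
  #|[set X | admissible (q <= #|F X|) setT X]| * 2 ^ #|~: N :\ i0|.
Proof.
rewrite -card_powerset -!sum1dep_card big_distrlr pair_big /=.
(* When [i0] is not a source, neither component records its bit; agreement with the outcome
   determines it, and [extra] puts it back. *)
pose extra (Z : {set 'I_n}) : {set 'I_n} :=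
  if (i0 \notin N) && (q <= #|F Z|) then [set i0] else set0.
rewrite [RHS](reindex_onto (fun X : {set 'I_n} => (X :&: N, X :&: (~: N :\ i0)))
  (fun p => p.1 :|: p.2 :|: extra p.1)) /=; last first.
  move=> [Z R] /= /andP[/andP[]]; rewrite setIT => sZ _ sR.
  have Ze u : u \in extra Z -> (u == i0) && (i0 \notin N).
    by rewrite /extra; case: ifP => [/andP[-> _]|_]; rewrite ?in_set0 // in_set1 => ->.
  congr (_, _); apply/setP => u; rewrite !in_setI !in_setU.
    case uZ : (u \in Z); first by rewrite (subsetP sZ).
    case uR : (u \in R) => /=.
      by have := subsetP sR u uR; rewrite !inE => /andP[_ /negbTE].
    case ue : (u \in extra Z) => //=.
    by have /andP[/eqP -> /negbTE] := Ze u ue.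
  case uR : (u \in R); first by rewrite (subsetP sR) // orbT.
  case uZ : (u \in Z) => /=.
    by have := subsetP sZ u uZ; rewrite in_setD1 in_setC => ->; rewrite andbF.
  case ue : (u \in extra Z) => //=.
  by have /andP[/eqP -> _] := Ze u ue; rewrite in_setD1 eqxx.
apply: eq_bigl => X; rewrite /admissible setIT !subsetIr !andbT /=.
rewrite in_setI /extra; set fb := (q <= _).
have EX : X :&: N :|: X :&: (~: N :\ i0) = if i0 \in N then X else X :\ i0.
  apply/setP => u; rewrite in_setU !in_setI in_setD1 in_setC.
  case: ifP => iN; rewrite ?in_setD1; have [-> | ne] := eqVneq u i0;
    rewrite ?iN ?andbT ?andbF ?orbF //=; case: (u \in N); rewrite ?andbT ?andbF ?orbF ?orbT //.
rewrite EX; case iN : (i0 \in N) => /=.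
  by rewrite setU0 eqxx !andbT eq_sym.
case: fb => /=.
  apply/eqP/eqP => [E|<-]; first by rewrite setUC setD1K.
  by rewrite in_setU in_set1 eqxx orbT.
rewrite setU0; apply/eqP/eqP => [E|<-]; last by rewrite in_setD1 eqxx.
by apply/setP => u; rewrite in_setD1; case: eqP => [->|].
Qed.

Theorem satisfactionE : players g = N -> threshold fs = quota g ->
  satisfaction fs = Sat g i0.
Proof.
move=> players_N threshold_fs.
rewrite /satisfaction order_fs threshold_fs sum_coefficients.
have -> : count (fun u => ~~ source fs u && ~~ (u == actor fs)) (iota 0 n) =
    #|~: N :\ i0|.
  rewrite count_iota; apply: eq_card => u; rewrite inE in_setD1 in_setC.
  by rewrite sourceE actor_fs andbC.
rewrite -card_decisions /Sat -!sum1dep_card.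
rewrite [RHS](reindex (fun X : {set 'I_n} => [ffun i => i \in X])) /=; last first.
  exists (fun x : {ffun 'I_n -> bool} => [set i | x i]) => [X|x] _.
    by apply/setP => i; rewrite inE ffunE.
  by apply/ffunP => i; rewrite ffunE inE.
apply: eq_bigl => X; rewrite /oblivious_decision players_N ffunE.
by congr (_ <= #|F (_ :&: _)| == _); apply/setP => i; rewrite inE ffunE.
Qed.

End Recursion.

End Correctness.

(** * The algorithm runs in polynomial time *)

Lemma FP_bignat_exp2 (A : encodable) (k : A -> nat) :
  FP k -> FP (fun a => Bignat (2 ^ k a)).
Proof.
move=> Hk; apply: (FP_ext _ (FP_bignat_mul_exp2 (FP_const (Bignat 1)) Hk)) => a.
by rewrite mul1n.
Qed.

Lemma FP_order (A : encodable) (fs : A -> seq (seq bool)) :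
  FP fs -> FP (fun a => order (fs a)).
Proof. by move=> Hfs; apply: (FP_size (FP_nth [::] Hfs (FP_const 1))). Qed.

Lemma FP_ywidth (A : encodable) (n : A -> nat) : FP n -> FP (fun a => ywidth (n a)).
Proof. exact: FP_succ. Qed.

Lemma FP_zwidth (A : encodable) (n : A -> nat) : FP n -> FP (fun a => zwidth (n a)).
Proof. by move=> Hn; apply: (FP_muln (FP_succ Hn) (FP_succ Hn)). Qed.

(** The rules using hypotheses handle parameters such as [fs] inside a loop body, where they are
    applied to a projection of the enlarged argument. *)
Ltac fp_step :=
  match goal with
  | |- FP (fun a => a) => exact: FP_id
  | |- FP (fun _ => ?b) => exact: FP_const
  | H : FP ?f |- FP ?f => exact: H
  | Hf : FP ?f |- FP (fun a => ?f (@?h a)) => refine (FP_comp (f := h) _ Hf)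
  | Hf : FP (fun p => ?f p.1 p.2) |- FP (fun a => ?f (@?h a) (@?k a)) =>
      refine (FP_comp (f := fun a => (h a, k a)) (FP_pair _ _) Hf)
  | |- FP (@fst _ _) => exact: (FP_fst FP_id)
  | |- FP (@snd _ _) => exact: (FP_snd FP_id)
  | |- FP (fun a => (@?f a).1) => refine (@FP_fst _ _ _ f _)
  | |- FP (fun a => (@?f a).2) => refine (@FP_snd _ _ _ f _)
  | |- FP (fun a => (@?f a, @?g a)) => refine (FP_pair _ _)
  | |- FP (fun a => @?f a + @?g a) => refine (FP_addn _ _)
  | |- FP (fun a => @?f a * @?g a) => refine (FP_muln _ _)
  | |- FP (fun a => (@?f a).+1) => refine (FP_succ _)
  | |- FP (fun a => @?f a <= @?g a) => refine (FP_leq _ _)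
  | |- FP (fun a => order (@?f a)) => refine (FP_order _)
  | |- FP (fun a => ywidth (@?f a)) => refine (FP_ywidth _)
  | |- FP (fun a => zwidth (@?f a)) => refine (FP_zwidth _)
  | |- FP (fun a => size (@?f a)) => refine (FP_size _)
  | |- FP (fun a => nth _ (@?f a) (@?g a)) => refine (FP_nth _ _ _)
  | |- FP (fun a => iota 0 (@?f a)) => refine (FP_iota _)
  | |- FP (fun a => Bignat (2 ^ @?f a)) => refine (FP_bignat_exp2 _)
  | |- FP (fun a => Bignat (bitval (@?f a))) => refine (FP_bignat_bits _)
  end.
Ltac fp := repeat fp_step.

Lemma FP_edge (A : encodable) (fs : A -> seq (seq bool)) (u v : A -> nat) :
  FP fs -> FP u -> FP v -> FP (fun a => edge (fs a) (u a) (v a)).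
Proof. by move=> Hfs Hu Hv; rewrite /edge; fp. Qed.

Lemma FP_label_num (A : encodable) (fs : A -> seq (seq bool)) (u : A -> nat) :
  FP fs -> FP u -> FP (fun a => Bignat (label_num (fs a) (u a))).
Proof. by move=> Hfs Hu; have Hn := FP_order Hfs; rewrite /label_num; fp. Qed.

Lemma FP_label_den (A : encodable) (fs : A -> seq (seq bool)) (u : A -> nat) :
  FP fs -> FP u -> FP (fun a => Bignat (label_den (fs a) (u a))).
Proof. by move=> Hfs Hu; have Hn := FP_order Hfs; rewrite /label_den; fp. Qed.

Lemma FP_threshold (A : encodable) (fs : A -> seq (seq bool)) :
  FP fs -> FP (fun a => Bignat (threshold (fs a))).
Proof. by move=> Hfs; have Hn := FP_order Hfs; rewrite /threshold; fp. Qed.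

Lemma FP_is_actor (A : encodable) (fs : A -> seq (seq bool)) (u : A -> nat) :
  FP fs -> FP u -> FP (fun a => u a == actor (fs a)).
Proof.
move=> Hfs Hu; have Hn := FP_order Hfs.
have Ha : FP (fun a => Bignat (actor (fs a))) by rewrite /actor; fp.
apply: (FP_ext (f := fun a => (u a <= actor (fs a)) && (actor (fs a) <= u a))).
  by move=> a; rewrite eqn_leq.
by apply: FP_andb; apply: FP_bignat_leq => //; apply: FP_bignat_of_nat.
Qed.

Lemma FP_source (A : encodable) (fs : A -> seq (seq bool)) (u : A -> nat) :
  FP fs -> FP u -> FP (fun a => source (fs a) (u a)).
Proof.
move=> Hfs Hu; rewrite /source.
apply: (FP_all (p := fun a w => ~~ edge (fs a) w (u a))).
  by apply: FP_iota; apply: FP_order.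
by apply: FP_negb; apply: FP_edge; fp.
Qed.

Lemma FP_sink (A : encodable) (fs : A -> seq (seq bool)) (u : A -> nat) :
  FP fs -> FP u -> FP (fun a => sink (fs a) (u a)).
Proof.
move=> Hfs Hu; rewrite /sink.
apply: (FP_all (p := fun a w => ~~ edge (fs a) (u a) w)).
  by apply: FP_iota; apply: FP_order.
by apply: FP_negb; apply: FP_edge; fp.
Qed.

Lemma FP_same_pred (A : encodable) (fs : A -> seq (seq bool)) (u v : A -> nat) :
  FP fs -> FP u -> FP v -> FP (fun a => same_pred (fs a) (u a) (v a)).
Proof.
move=> Hfs Hu Hv; rewrite /same_pred.
apply: (FP_all (p := fun a k => edge (fs a) k (u a) == edge (fs a) k (v a))).
  by apply: FP_iota; apply: FP_order.
by apply: FP_eqb; apply: FP_edge; fp.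
Qed.

Lemma FP_canonical (A : encodable) (fs : A -> seq (seq bool)) (u : A -> nat) :
  FP fs -> FP u -> FP (fun a => canonical (fs a) (u a)).
Proof.
move=> Hfs Hu; apply: FP_negb.
apply: (FP_has (p := fun a w => same_pred (fs a) (u a) w)); first by fp.
by apply: FP_same_pred; fp.
Qed.

Lemma FP_activated (A : encodable) (fs : A -> seq (seq bool)) (u b : A -> nat) :
  FP fs -> FP u -> FP b -> FP (fun a => activated (fs a) (u a) (b a)).
Proof.
move=> Hfs Hu Hb; rewrite /activated.
apply: (FP_count (p := fun a w => same_pred (fs a) (u a) w &&
   (label_num (fs a) w <= b a * label_den (fs a) w))).
  by apply: FP_iota; apply: FP_order.
apply: FP_andb; first by apply: FP_same_pred; fp.
apply: FP_bignat_leq; first by apply: FP_label_num; fp.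
by apply: FP_bignat_mul; [apply: FP_bignat_of_nat | apply: FP_label_den]; fp.
Qed.

Lemma FP_collapse (A : encodable) (n p : A -> nat) (c : A -> nat -> nat) :
  FP n -> FP (fun a => Bignat (p a)) -> FP (fun q : A * nat => c q.1 q.2) ->
  FP (fun a => Bignat (collapse (n a) (p a) (c a))).
Proof.
move=> Hn Hp Hc; rewrite /collapse.
have Hy := FP_ywidth Hn; have Hz := FP_zwidth Hn.
apply: (FP_bignat_sum (f := fun a b =>
  ((p a %/ 2 ^ (zwidth (n a) * b)) %% 2 ^ zwidth (n a)) *
    2 ^ ((ywidth (n a) + zwidth (n a)) * c a b))); first by fp.
have Hp' : FP (fun q : A * nat => Bignat (p q.1)).
  exact: (FP_comp (FP_fst FP_id) Hp).
apply: FP_bignat_mul_exp2; last by fp.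
by apply: FP_bignat_mod_exp2; [apply: FP_bignat_div_exp2; fp | fp].
Qed.

Lemma FP_weight (A : encodable) (fs : A -> seq (seq bool)) (fb : A -> bool)
    (u : A -> nat) : FP fs -> FP fb -> FP u ->
  FP (fun a => Bignat (weight (fs a) (fb a) (u a))).
Proof.
move=> Hfs Hfb Hu; have Hn := FP_order Hfs.
have Hyz := FP_addn (FP_ywidth Hn) (FP_zwidth Hn).
apply: (FP_ext (f := fun a => if u a == actor (fs a) then
    (if fb a then Bignat (2 ^ (ywidth (order (fs a)) + zwidth (order (fs a))))
     else Bignat 1)
  else Bignat (1 + 2 ^ (ywidth (order (fs a)) + zwidth (order (fs a)))))).
  by move=> a; rewrite /weight; do 2?case: ifP.
apply: FP_if; [exact: FP_is_actor | apply: FP_if; fp | ].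
apply: FP_bignat_add; first exact: (FP_const (Bignat 1)).
exact: FP_bignat_exp2.
Qed.

Lemma FP_factor (A : encodable) (fs : A -> seq (seq bool)) (fb : A -> bool)
    (T : A -> seq bignat) (u : A -> nat) : FP fs -> FP fb -> FP T -> FP u ->
  FP (fun a => Bignat (factor (fs a) (fb a) (T a) (u a))).
Proof.
move=> Hfs Hfb HT Hu.
apply: (FP_ext (f := fun a =>
  if source (fs a) (u a) then Bignat (weight (fs a) (fb a) (u a))
  else if canonical (fs a) (u a) then nth (Bignat 0) (T a) (u a)
  else Bignat 1)).
  by move=> a; rewrite /factor; do 2?case: ifP => _ //; case: nth.
apply: FP_if; [exact: FP_source | exact: FP_weight | ].
by apply: FP_if; [exact: FP_canonical | exact: FP_nth | fp].
Qed.

Lemma FP_product (A : encodable) (fs : A -> seq (seq bool)) (fb : A -> bool)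
    (T : A -> seq bignat) (S : A -> nat -> bool) :
  FP fs -> FP fb -> FP T -> FP (fun q : A * nat => S q.1 q.2) ->
  FP (fun a => Bignat (product (fs a) (fb a) (T a) (S a))).
Proof.
move=> Hfs Hfb HT HS; rewrite /product.
apply: (FP_bignat_prod (f := fun a u => if S a u then factor (fs a) (fb a) (T a) u else 1)).
  by apply: FP_iota; apply: FP_order.
apply: (FP_ext (f := fun q : A * nat => if S q.1 q.2 then
   Bignat (factor (fs q.1) (fb q.1) (T q.1) q.2) else Bignat 1)).
  by move=> q; case: ifP.
by apply: FP_if => //; [apply: FP_factor; fp | fp].
Qed.

Lemma FP_entry (A : encodable) (fs : A -> seq (seq bool)) (fb : A -> bool)
    (T : A -> seq bignat) (u : A -> nat) : FP fs -> FP fb -> FP T -> FP u ->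
  FP (fun a => Bignat (entry (fs a) (fb a) (T a) (u a))).
Proof.
move=> Hfs Hfb HT Hu; have Hn := FP_order Hfs; rewrite /entry.
apply: FP_bignat_mod_exp2; last by apply: FP_muln; [exact: FP_zwidth | fp].
apply: (FP_collapse (c := fun a => activated (fs a) (u a))) => //.
  apply: (FP_product (S := fun a w => edge (fs a) w (u a))) => //.
  by apply: FP_edge; fp.
by apply: FP_activated; fp.
Qed.

Lemma FP_table (A : encodable) (fs : A -> seq (seq bool)) (fb : A -> bool)
    (t : A -> nat) : FP fs -> FP fb -> FP t ->
  FP (fun a => table (fs a) (fb a) (t a)).
Proof.
move=> Hfs Hfb Ht; have Hn := FP_order Hfs; rewrite /table.
pose K a := zwidth (order (fs a)) * (order (fs a)).+1.
have HK : FP K by apply: FP_muln; [exact: FP_zwidth | fp].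
apply: (FP_iter (g := fun a T =>
    [seq Bignat (entry (fs a) (fb a) T u) | u <- iota 0 (order (fs a))])
  (b := fun a => order (fs a) * (4 * K a + 2) + 1)) => //.
- exact: FP_const.
- apply: (FP_map (f := fun (p : A * seq bignat) u => Bignat (entry (fs p.1) (fb p.1) p.2 u))).
    by fp.
  by apply: FP_entry; fp.
- by have := FP_bounded_nat Hn; have := FP_bounded_nat HK => *; pbound.
- move=> a [_|j _]; first by rewrite addn1.
  rewrite iterS; set T := iter _ _ _.
  rewrite -{2}(size_iota 0 (order (fs a))); elim: (iota _ _) => // u s IH.
  rewrite /= esize_cons mulSn.
  (* The truncation in [entry] yields this for arbitrary [T] and [fs]. *)
  have : esize (Bignat (entry (fs a) (fb a) T u)) <= 4 * K a + 1.
    by apply: esize_bignat; rewrite ltn_mod expn_gt0.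
  lia.
Qed.

Lemma FP_coefficient (A : encodable) (fs : A -> seq (seq bool)) (fb : A -> bool)
    (a : A -> nat) : FP fs -> FP fb -> FP a ->
  FP (fun x => Bignat (coefficient (fs x) (fb x) (a x))).
Proof.
move=> Hfs Hfb Ha; have Hn := FP_order Hfs; have Hy := FP_ywidth Hn.
rewrite /coefficient; apply: FP_bignat_mod_exp2 => //.
apply: FP_bignat_div_exp2; last by fp.
rewrite /total; apply: (FP_collapse (c := fun _ _ => 0)) => //; last by fp.
apply: (FP_product (S := fun x => sink (fs x))) => //; first exact: FP_table.
by apply: FP_sink; fp.
Qed.

Theorem FP_satisfaction (A : encodable) (fs : A -> seq (seq bool)) :
  FP fs -> FP (fun a => Bignat (satisfaction (fs a))).
Proof.
move=> Hfs; have Hn := FP_order Hfs; rewrite /satisfaction.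
apply: FP_bignat_mul_exp2.
  apply: (FP_bignat_sum (f := fun x a => coefficient (fs x) (threshold (fs x) <= a) a)).
    by fp.
  apply: FP_coefficient; try by fp.
  by apply: FP_bignat_leq; [apply: FP_threshold | apply: FP_bignat_of_nat]; fp.
apply: (FP_count (p := fun x u => ~~ source (fs x) u && ~~ (u == actor (fs x)))).
  exact: FP_iota.
by apply: FP_andb; apply: FP_negb; [apply: FP_source | apply: FP_is_actor]; fp.
Qed.

(** * Input and output *)

(** The strings pushed are those that prolong the code of a list by one cell: the head [true] has
    code 1 0 0, the head [false] has code 0, and a cell begins with 1. Bits are consumed from the
    front, so the resulting list is reversed. *)
Definition read_input : prog :=
  Seq (Push (0 + 1) false)
 (Seq (Loop (0 + 0) (Case (0 + 0)
        (Seq (Pop (0 + 0)) (push_all (0 + 1) [:: true; true; false; false]))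
        (Seq (Pop (0 + 0)) (push_all (0 + 1) [:: true; false])) Skip))
      (move3 (0 + 1) (0 + 0) (0 + 2))).

Lemma does_read_input m w :
  does read_input (layout m 0 [:: w])
    (2 + ((12 * size w).+1 + (10 * esize (rev w) + 2)))
    (layout m 0 [:: code (encode (rev w))]).
Proof.
apply: does_seq (does_push m 0 [:: w] 1 false) _ => /=.
have main l : does (Loop (0 + 0) (Case (0 + 0)
     (Seq (Pop (0 + 0)) (push_all (0 + 1) [:: true; true; false; false]))
     (Seq (Pop (0 + 0)) (push_all (0 + 1) [:: true; false])) Skip))
   (layout m 0 [:: w; code (encode l)]) (12 * size w).+1
   (layout m 0 [:: [::]; code (encode (catrev w l))]).
  elim: w l => [|b w IH] l.
    by rewrite muln0; apply: does_loop_end; rewrite layoutE.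
  have -> : (12 * size (b :: w)).+1 = (11 + (12 * size w).+1).+1 by rewrite /=; lia.
  apply: (@does_loop _ _ _ (layout m 0 [:: w; code (encode (b :: l))])).
  - by rewrite layoutE.
  - apply: does_case; rewrite layoutE /=; case: b => /=.
      apply: (does_seq (T1 := 1) (T2 := 9) (does_pop _ _ _ _)) => /=.
      exact: (does_push_all m 0 [:: w; code (encode l)] 1 [:: true; true; false; false]).
    apply: (@does_le _ _ 6) => //.
    apply: (does_seq (T1 := 1) (T2 := 5) (does_pop _ _ _ _)) => /=.
    exact: (does_push_all m 0 [:: w; code (encode l)] 1 [:: true; false]).
  - exact: IH.
apply: does_seq (main [::]) _; rewrite /esize -size_code.
have := @does_move3 m 0 [:: [::]; code (encode (rev w))] 1 0 2 isT isT isT isT erefl erefl.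
by rewrite /= (layout_rcons m 0 [:: code (encode (rev w))]).
Qed.

Definition write_output : prog :=
  Seq (Loop (0 + 0) (Case (0 + 0)
        (Seq (Pop (0 + 0)) (Case (0 + 0)
           (Seq (Pop (0 + 0)) (Seq (Pop (0 + 0))
             (Seq (Pop (0 + 0)) (Push (0 + 1) true))))
           (Seq (Pop (0 + 0)) (Push (0 + 1) false)) Skip))
        (Pop (0 + 0)) Skip))
      (transfer (0 + 1) (0 + 0)).

Lemma does_write_output m s :
  does write_output (layout m 0 [:: code (encode s)])
    (9 * size s + 4 + (5 * size s).+1) (layout m 0 [:: s]).
Proof.
have main l : does (Loop (0 + 0) (Case (0 + 0)
        (Seq (Pop (0 + 0)) (Case (0 + 0)
           (Seq (Pop (0 + 0)) (Seq (Pop (0 + 0))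
             (Seq (Pop (0 + 0)) (Push (0 + 1) true))))
           (Seq (Pop (0 + 0)) (Push (0 + 1) false)) Skip))
        (Pop (0 + 0)) Skip))
   (layout m 0 [:: code (encode s); l]) (9 * size s + 4)
   (layout m 0 [:: [::]; catrev s l]).
  elim: s l => [|b s IH] l.
    apply: (@does_le _ _ (2 + 1).+1) => //; apply: does_loop.
    - by rewrite layoutE.
    - by apply: does_case; rewrite layoutE; apply: does_pop.
    - by apply: does_loop_end; rewrite layoutE.
  have -> : 9 * size (b :: s) + 4 = (8 + (9 * size s + 4)).+1 by rewrite /=; lia.
  apply: (@does_loop _ _ _ (layout m 0 [:: code (encode s); b :: l])).
  - by rewrite layoutE.
  - apply: does_case; rewrite layoutE /=.
    apply: (does_seq (T1 := 1) (T2 := 6) (does_pop _ _ _ _)) => /=.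
    apply: does_case; rewrite layoutE /=; case: b => /=.
      apply: (does_seq (T1 := 1) (T2 := 4) (does_pop _ _ _ _)) => /=.
      apply: (does_seq (T1 := 1) (T2 := 3) (does_pop _ _ _ _)) => /=.
      apply: (does_seq (T1 := 1) (T2 := 2) (does_pop _ _ _ _)) => /=.
      exact: (does_push m 0 [:: code (encode s); l] 1 true).
    apply: (@does_le _ _ 3) => //.
    apply: (does_seq (T1 := 1) (T2 := 2) (does_pop _ _ _ _)) => /=.
    exact: (does_push m 0 [:: code (encode s); l] 1 false).
  - exact: IH.
apply: (@does_seq _ _ _ _ (layout m 0 [:: [::]; rev s])).
  by have := main [::]; rewrite (layout_rcons m 0 [:: code (encode s)]).
have := @does_transfer m 0 [:: [::]; rev s] 1 0 isT isT.
by rewrite /= catrevE revK cats0 size_rev (layout_rcons m 0 [:: s]).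
Qed.

Lemma input_mem_layout w : input_mem w = layout (fun _ => [::]) 0 [:: w].
Proof. by apply: functional_extensionality => -[|[|j]]. Qed.

Theorem polytime_computable_FP (I : Type) (valid : I -> Prop)
    (input output : I -> seq bool) (f : seq bool -> seq bool) :
  FP f -> (forall x, valid x -> f (input x) = output x) ->
  polytime_computable valid input output.
Proof.
move=> Hf fE.
(* Compensates for the reversal by [read_input]. *)
have Hg : FP (fun w => f (rev w)) by exact: (FP_comp (FP_rev FP_id) Hf).
have [p [T [HT Hp]]] := Hg 0.
pose total w := 2 + (12 * esize w + 1 + (10 * esize w + 2)) +
  (T w + (14 * esize (f (rev w)) + 5)).
have [c [d Htotal]] : esize_bounded total.
  have Hs := FP_esize Hg; have H1 : esize_bounded (fun w : seq bool => esize w).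
    exact: poly_bounded_size.
  by rewrite /total; pbound.
(* The factor 5^d comes from [esize w <= 4 * size w + 1], which is at most 5 times the length of a
   nonempty input; the additive constant covers the empty input. *)
exists (machine (Seq read_input (Seq p write_output))), (c * 5 ^ d), d => x vx.
set w := input x.
have [t le_t Ht] : does (Seq read_input (Seq p write_output)) (input_mem w)
    (c * 5 ^ d * size w ^ d + c * 5 ^ d) (layout (fun _ => [::]) 0 [:: output x]).
  apply: (@does_le _ _ (c * esize (rev w) ^ d)).
    rewrite -mulnA -mulnDr leq_mul2l; apply/orP; right; rewrite esize_rev.
    have [/size0nil -> | w0] := posnP (size w).
      by rewrite exp1n; apply: leq_trans (leq_addl _ _); rewrite expn_gt0.
    apply: leq_trans (leq_addr _ _); rewrite -expnMn leq_wexp2r //.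
    by have := esize_bits w; lia.
  apply: does_le (Htotal (rev w)) _; rewrite /total revK input_mem_layout.
  rewrite -fE // -/w.
  apply: does_seq.
    apply: does_le (does_read_input _ w).
    by have : size w < esize w := size_le_esize w; rewrite esize_rev; lia.
  apply: does_seq; first by have := Hp (rev w) (fun _ => [::]); rewrite revK; apply.
  apply: does_le (does_write_output _ _).
  have arith a b : a < b -> 9 * a + 4 + (5 * a).+1 <= 14 * b + 5 by lia.
  exact: arith (size_le_esize _).
have := machine_computes Ht le_t.
by rewrite /layout.
Qed.

(** * Parsing *)

(* The state consists of the completed fields and the current field, both
   reversed, and of a flag telling whether the next bit is a payload bit. *)
Definition parse_step (st : seq (seq bool) * seq bool * bool) (b : bool) :=
  if st.2 then (st.1.1, b :: st.1.2, false)
  else if b then (st.1, true) else (rev st.1.2 :: st.1.1, [::], false).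

Definition parse (w : seq bool) : seq (seq bool) :=
  rev (foldl parse_step ([::], [::], false) w).1.1.

Lemma parse_fields ss : parse (flatten [seq delimited s | s <- ss]) = ss.
Proof.
have field s r F c : foldl parse_step (F, c, false) (delimited s ++ r) =
    foldl parse_step (rev (catrev s c) :: F, [::], false) r.
  by elim: s c => [|b s IH] c //=; rewrite -IH.
have main F : foldl parse_step (F, [::], false) (flatten [seq delimited s | s <- ss]) =
    (catrev ss F, [::], false).
  elim: ss F => //= s ss IH F; rewrite field IH /=.
  by rewrite -/(rev s) revK.
by rewrite /parse main /= -/(rev ss) revK.
Qed.

Lemma FP_parse : FP parse.
Proof.
apply: FP_rev; apply: FP_fst; apply: FP_fst.
(* Closing a field moves its bits from one list to the other, so the total grows by a bounded amount
   per input bit. *)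
have bound s : let st := foldl parse_step ([::], [::], false) s in
    esize st.1.1 + esize st.1.2 <= 5 * size s + 2.
  elim/last_ind: s => // s b; rewrite foldl_rcons size_rcons /=.
  case: foldl => -[F c] /= [] IH; rewrite /parse_step /=.
    by rewrite esize_cons; have := esize_bool b; lia.
  case: b => /=; first by lia.
  by rewrite esize_cons esize_rev; have : esize (Nil bool) = 1 by []; lia.
apply: (FP_foldl (g := fun _ => parse_step) (b := fun w => 5 * esize w + 7)).
- exact: FP_id.
- exact: FP_const.
- rewrite /parse_step; apply: FP_if; first by fp.
    by apply: FP_pair; [apply: FP_pair; [fp | apply: FP_cons; fp] | fp].
  apply: FP_if; [by fp | by fp |].
  apply: FP_pair; [apply: FP_pair; last by fp | by fp].
  by apply: FP_cons; [apply: FP_rev; fp | fp].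
- by pbound; apply: poly_bounded_size.
- move=> w j; have := bound (take j w).
  have : size (take j w) < esize w.
    by apply: leq_trans (size_le_esize _) (esize_take _ _).
  case: foldl => -[F c] b /=; rewrite !esize_pair; have := esize_bool b; lia.
Qed.

(** * The fields of an encoded instance *)

Section Instance.
Variables (n : nat) (g : influence_game 'I_n) (i : 'I_n).

Definition instance_fields : seq (seq bool) :=
  let V := enum 'I_n in
  binary n ::
    [seq [seq (u, v) \in game_edges g | v <- V] | u <- V] ++
    [seq binary `|numq (label g u)|%N | u <- V] ++
    [seq binary `|denq (label g u)|%N | u <- V] ++
    [:: [seq v \in players g | v <- V]; binary (quota g); binary i].

Local Notation fs := instance_fields.

Lemma size_map_enum T (f : 'I_n -> T) : size [seq f u | u <- enum 'I_n] = n.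
Proof. by rewrite size_map size_enum_ord. Qed.

Lemma nth_map_enum T (x : T) (f : 'I_n -> T) (u : 'I_n) :
  nth x [seq f u | u <- enum 'I_n] u = f u.
Proof. by rewrite (nth_map u) ?size_enum_ord // nth_ord_enum. Qed.

Lemma order_instance : order fs = n.
Proof.
have n0 : 0 < n by exact: leq_ltn_trans (leq0n i) (ltn_ord i).
rewrite /order /fs /= nth_cat size_map_enum n0.
by rewrite (nth_map i) ?size_enum_ord // size_map_enum.
Qed.

Lemma edge_instance (u v : 'I_n) : edge fs u v = ((u, v) \in game_edges g).
Proof. by rewrite /edge /= nth_cat size_map_enum ltn_ord !nth_map_enum. Qed.

Lemma label_num_instance (u : 'I_n) : label_num fs u = `|numq (label g u)|%N.
Proof.
rewrite /label_num order_instance /= !nth_cat !size_map_enum.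
rewrite ltnNge leq_addr /= addKn ltn_ord nth_map_enum.
by rewrite bitval_binary.
Qed.

Lemma label_den_instance (u : 'I_n) : label_den fs u = `|denq (label g u)|%N.
Proof.
rewrite /label_den order_instance /= !nth_cat !size_map_enum.
rewrite -addnA ltnNge leq_addr /= addKn ltnNge leq_addr /= addKn.
by rewrite ltn_ord nth_map_enum bitval_binary.
Qed.

(** Clearing the positive denominator reduces the comparison to integers; the label is non-negative,
    so the absolute value of its numerator is the numerator. *)
Lemma label_instance (u : 'I_n) b :
  (label_num fs u <= b * label_den fs u) = (label g u <= b%:R)%R.
Proof.
rewrite label_num_instance label_den_instance.
set r := label g u; have r0 : (0 <= r)%R := label_ge0 g u.
rewrite -{3}(divq_num_den r) ler_pdivrMr ?ltr0z ?denq_gt0 //.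
rewrite -[(b%:R)%R]/((b%:Z)%:~R)%R -intrM ler_int -lez_nat PoszM.
by rewrite absz_denq gez0_abs // numq_ge0.
Qed.

Lemma threshold_instance : threshold fs = quota g.
Proof.
rewrite /threshold order_instance /= !nth_cat !size_map_enum.
rewrite ifN; last by rewrite -leqNgt; lia.
rewrite ifN; last by rewrite -leqNgt; lia.
rewrite ifN; last by rewrite -leqNgt; lia.
have -> : (n + n + n).+1 - n - n - n = 1 by lia.
by rewrite /= bitval_binary.
Qed.

Lemma actor_instance : actor fs = i.
Proof.
rewrite /actor order_instance /= !nth_cat !size_map_enum.
rewrite ifN; last by rewrite -leqNgt; lia.
rewrite ifN; last by rewrite -leqNgt; lia.
rewrite ifN; last by rewrite -leqNgt; lia.
have -> : (n + n + n).+2 - n - n - n = 2 by lia.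
by rewrite /= bitval_binary.
Qed.

Lemma satisfaction_instance : strong_hierarchical_game g -> positive_labels g ->
  satisfaction fs = Sat g i.
Proof.
move=> [strong_g playersE] pos.
apply: (satisfactionE pos order_instance edge_instance label_instance
  actor_instance strong_g _ threshold_instance).
rewrite playersE; apply/setP => v; rewrite !inE.
by do 2?case: eqP.
Qed.

End Instance.

Theorem theorem3 :
  polytime_computable
    (fun p : sat_instance =>
       strong_hierarchical_game (inst_game p) /\ positive_labels (inst_game p))
    encode_instance
    (fun p : sat_instance => binary (Sat (inst_game p) (inst_actor p))).
Proof.
apply: (polytime_computable_FP (f := fun w => binary (satisfaction (parse w)))).
  by apply: FP_bits; apply: FP_satisfaction; apply: FP_parse.
move=> [n g i] /= [strong_g pos]; congr binary.
by rewrite parse_fields -/(instance_fields g i) satisfaction_instance.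
Qed.
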